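(* Let $G$ be a perfectly labeled graph on $[n]$ such that $NC_G$ has a maximum element $\hat1$. Then: (a) $NC_G$ is graded and $\rho(H)=n-cc(H)$ for $H\in NC_G$. (b) The minimum labeling with respect to the colexicographic order on $E(G)$ is an EL-labeling of $NC_G$, and so $NC_G$ is shellable. (c) For $H\in NC_G$, $$\mu(H)=(-1)^{n-cc(H)}\mathrm{ncnbc}_{n-cc(H)}(H)=(-1)^{n-cc(H)}\mathrm{ncisf}_{n-cc(H)}(H),$$ and $$\chi(NC_G,t)=\sum_{k\ge0}(-1)^k\mathrm{ncnbc}_k(G)\,t^{\rho(NC_G)-k}=\sum_{k\ge0}(-1)^k\mathrm{ncisf}_k(G)\,t^{\rho(NC_G)-k},$$ where NBC sets are taken with respect to the colexicographic order on $E(G)$.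
   Context: All graphs are finite simple graphs with vertex set $[n]=\{1,\dots,n\}$; edges are written $ij$ with $i<j$. Two edges $a_1a_2$ and $b_1b_2$ cross if $a_1<b_1<a_2<b_2$ or $b_1<a_1<b_2<a_2$. $G$ is perfectly labeled if whenever $ik,jk\in E(G)$ with $i<j<k$, also $ij\in E(G)$. Colexicographic order on edges: $ab\lhd a'b'$ iff $b<b'$, or $b=b'$ and $a<a'$. A spanning subgraph is identified with its edge set; $cc(X)$ is the number of connected components. A bond of $G$ is a spanning subgraph each of whose components is an induced subgraph of $G$; it is noncrossing if there are no two distinct components with vertex sets $B,B'$ and $a,c\in B$, $b,d\in B'$, $a<b<c<d$. $NC_G$ is the poset of noncrossing bonds ordered by inclusion of edge sets, with minimum $\hat0$ the empty bond. The minimum labeling assigns to a cover $H\lessdot H'$ the label $\min(E(H')\setminus E(H))$. An EL-labeling: every interval has a unique maximal chain with strictly increasing labels, and it lexicographically precedes all other maximal chains of the interval. Shellable means the order complex is shellable. A broken circuit is the edge set of a cycle with its smallest edge removed; an NBC set contains no broken circuit; a noncrossing NBC set is an NBC set with no two crossing edges; $\mathrm{ncnbc}_k(X)$ is the number of such sets of size $k$ in the graph $X$. A tree whose vertices are integers is increasing if the vertices along any path from its smallest vertex form an increasing sequence; an increasing spanning forest of $X$ is a spanning subgraph each of whose components is an increasing tree; it is noncrossing if no two of its edges cross; $\mathrm{ncisf}_k(X)$ is the number of noncrossing increasing spanning forests of $X$ with $k$ edges. Möbius function: $\mu(\hat0)=1$, $\mu(x)=-\sum_{y<x}\mu(y)$;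 $\chi(P,t)=\sum_{x\in P}\mu(x)t^{\rho(P)-\rho(x)}$, $\rho(P)$ the rank of $P$. *)

(* Defs.v *)
(* Vertices [n] = {1..n} are modelled by 'I_n = {0..n-1}
   (order-preserving relabelling i |-> i-1). *)
From HB Require Import structures.
From mathcomp Require Import all_boot all_order all_algebra.
Set Implicit Arguments. Unset Strict Implicit. Unset Printing Implicit Defensive.
Import GRing.Theory Num.Theory.

(* an edge ij is the pair (i,j) with i < j *)
Definition edge (n : nat) := ('I_n * 'I_n)%type.

Definition simple_graph {n : nat} (G : {set edge n}) : Prop :=
  forall e, e \in G -> (e.1 < e.2)%N.

Definition perfectly_labeled {n : nat} (G : {set edge n}) : Prop :=
  forall i j k : 'I_n, (i < j < k)%N -> (i, k) \in G -> (j, k) \in G -> (i, j) \in G.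

(* spanning subgraphs are identified with their edge sets *)
Definition adj {n : nat} (H : {set edge n}) : rel 'I_n :=
  fun x y => ((x, y) \in H) || ((y, x) \in H).
Definition conn {n : nat} (H : {set edge n}) : rel 'I_n := connect (adj H).

Definition cc {n : nat} (H : {set edge n}) : nat :=
  #|[set [set y | conn H x y] | x : 'I_n]|.

Definition bond {n : nat} (G H : {set edge n}) : bool :=
  (H \subset G) && [forall e in G, conn H e.1 e.2 ==> (e \in H)].

Definition noncrossing_comps {n : nat} (H : {set edge n}) : bool :=
  [forall a : 'I_n, forall b : 'I_n, forall c : 'I_n, forall d : 'I_n,
     [&& (a < b < c)%N, (c < d)%N, conn H a c & conn H b d] ==> conn H a b].

Definition ncbond {n : nat} (G H : {set edge n}) : bool :=
  bond G H && noncrossing_comps H.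

Definition has_max {n : nat} (G : {set edge n}) : Prop :=
  exists T, ncbond G T /\ forall H, ncbond G H -> H \subset T.

Definition chainb {n : nat} (G : {set edge n}) (C : {set {set edge n}}) : bool :=
  [forall x in C, ncbond G x] &&
  [forall x in C, forall y in C, (x \subset y) || (y \subset x)].

Definition graded {n : nat} (G : {set edge n}) : Prop :=
  forall C1 C2, maxset (chainb G) C1 -> maxset (chainb G) C2 -> #|C1| = #|C2|.

(* rank of x: length of a longest chain of the interval [0^, x]
   (in a graded poset this is the rank function) *)
Definition rk {n : nat} (G : {set edge n}) (x : {set edge n}) : nat :=
  (\max_(C : {set {set edge n}} | chainb G C && [forall y in C, y \subset x]) #|C|).-1.
Definition rkP {n : nat} (G : {set edge n}) : nat :=
  (\max_(C : {set {set edge n}} | chainb G C) #|C|).-1.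

Definition cover {n : nat} (G : {set edge n}) (x y : {set edge n}) : bool :=
  [&& ncbond G x, ncbond G y, x \proper y &
      ~~ [exists z, [&& ncbond G z, x \proper z & z \proper y]]].

Definition satchain {n : nat} (G : {set edge n}) (x y : {set edge n}) (s : seq {set edge n}) :=
  path (cover G) x s && (last x s == y).

Definition colex_lt {n : nat} (e f : edge n) : bool :=
  (e.2 < f.2)%N || ((e.2 == f.2) && (e.1 < f.1)%N).
Definition colex_key {n : nat} (e : edge n) : nat := e.2 * n + e.1.

Lemma colex_ltE {n : nat} (e f : edge n) : colex_lt e f = (colex_key e < colex_key f)%N.
Proof.
case: e f => [a b] [c d]; rewrite /colex_lt /colex_key /=.
have ha := ltn_ord a; have hc := ltn_ord c.
case: (ltngtP b d) => [hbd|hbd|/val_inj ->] /=.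
- symmetry; apply/idP; apply: (@leq_trans (b * n + n)); first by rewrite ltn_add2l.
  by rewrite -mulSnr (leq_trans _ (leq_addr _ _)) // leq_mul2r hbd orbT.
- have -> : (b == d) = false by apply/eqP => E; rewrite E ltnn in hbd.
  symmetry; apply: negbTE; rewrite -leqNgt; apply: (@leq_trans (d * n + n)).
    by rewrite leq_add2l ltnW.
  by rewrite -mulSnr (leq_trans _ (leq_addr _ _)) // leq_mul2r hbd orbT.
- by rewrite eqxx ltn_add2l.
Qed.

(* minimum labeling w.r.t. colex: label of x <. y is min(E(y) \ E(x)),
   encoded by its colex key *)
Definition lab {n : nat} (x y : {set edge n}) : nat :=
  \big[minn/(n * n)%N]_(e in y :\: x) colex_key e.
Definition labels {n : nat} (x : {set edge n}) (s : seq {set edge n}) : seq nat :=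
  pairmap lab x s.

Fixpoint lexlt (s t : seq nat) : bool :=
  match s, t with
  | [::], [::] => false
  | [::], _ :: _ => true
  | _ :: _, [::] => false
  | a :: s', b :: t' => (a < b)%N || ((a == b) && lexlt s' t')
  end.

Definition EL_min_colex {n : nat} (G : {set edge n}) : Prop :=
  forall x y, ncbond G x -> ncbond G y -> x \subset y ->
  exists s, [/\ satchain G x y s, sorted ltn (labels x s),
     (forall s', satchain G x y s' -> sorted ltn (labels x s') -> s' = s) &
     (forall s', satchain G x y s' -> s' != s -> lexlt (labels x s) (labels x s'))].

Definition shellable {V : finType} (facet : pred {set V}) : Prop :=
  exists Fs : seq {set V},
  [/\ uniq Fs, (forall F, (F \in Fs) = facet F) &
      forall k, (0 < k < size Fs)%N ->
        let Fk := nth set0 Fs k in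
        let inSigma (S : {set V}) :=
          (S \subset Fk) && [exists i : 'I_k, S \subset nth set0 Fs i] in
        (* (U_{i<k} <F_i>) /\ <F_k> is pure of dimension dim F_k - 1 *)
        forall S, inSigma S ->
          (#|S| <= #|Fk|.-1)%N /\
          exists S', [/\ inSigma S', S \subset S' & #|S'| = #|Fk|.-1]].

(* order complex of NC_G: faces = chains, facets = maximal chains *)
Definition NC_shellable {n : nat} (G : {set edge n}) : Prop :=
  shellable (maxset (chainb G)).

Definition nedge {n : nat} (x y : 'I_n) : edge n := if (x < y)%N then (x, y) else (y, x).

Definition cycle_edges {n : nat} (X C : {set edge n}) : bool :=
  [exists m : 'I_n.+1, exists p : m.-tuple 'I_n,
     [&& (2 < m)%N, uniq p, C == [set nedge x (next p x) | x in p] & C \subset X]].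

Definition broken_circuit {n : nat} (X B : {set edge n}) : bool :=
  [exists C, cycle_edges X C &&
     [exists e in C, [forall f in C, ~~ colex_lt f e] && (B == C :\ e)]].

Definition nbc {n : nat} (X S : {set edge n}) : bool :=
  (S \subset X) && ~~ [exists B, broken_circuit X B && (B \subset S)].

Definition crossb {n : nat} (e f : edge n) : bool :=
  [&& (e.1 < f.1)%N, (f.1 < e.2)%N & (e.2 < f.2)%N] ||
  [&& (f.1 < e.1)%N, (e.1 < f.2)%N & (f.2 < e.2)%N].

Definition noncrossing_edges {n : nat} (S : {set edge n}) : bool :=
  [forall e in S, forall f in S, ~~ crossb e f].

Definition ncnbc {n : nat} (X : {set edge n}) (k : nat) : nat :=
  #|[set S | [&& nbc X S, noncrossing_edges S & #|S| == k]]|.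

Definition acyclic {n : nat} (F : {set edge n}) : bool :=
  ~~ [exists C, cycle_edges F C].

Definition increasing {n : nat} (F : {set edge n}) : bool :=
  [forall r : 'I_n, [forall v : 'I_n, conn F r v ==> (r <= v)%N] ==>
     [forall m : 'I_n.+1, forall p : m.-tuple 'I_n,
        (path (adj F) r p && uniq (r :: p)) ==> sorted ltn (map val (r :: p))]].

Definition isf {n : nat} (X F : {set edge n}) : bool :=
  [&& F \subset X, acyclic F & increasing F].

Definition ncisf {n : nat} (X : {set edge n}) (k : nat) : nat :=
  #|[set F | [&& isf X F, noncrossing_edges F & #|F| == k]]|.

Definition mobius_fun {n : nat} (G : {set edge n}) (mu : {set edge n} -> int) : Prop :=
  mu set0 = 1%R /\
  forall H, ncbond G H -> H != set0 ->
    mu H = (- \sum_(K | ncbond G K && (K \proper H)) mu K)%R.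

Definition charpoly {n : nat} (G : {set edge n}) (mu : {set edge n} -> int) : {poly int} :=
  (\sum_(H | ncbond G H) (mu H)%:P * 'X^(rkP G - rk G H))%R.

(* Main.v *)
(* Write [tops X] for the set of larger endpoints of the edges of [X].  In a perfectly
   labeled graph a vertex lies outside [tops X] exactly when it is the minimum of its
   component, so [n - cc X] is the size of [tops X], which increases strictly along
   inclusions of bonds.

   If [x] is properly contained in [y] and [ab] is the colex-smallest edge of [y]
   outside [x], then every vertex below [b] in the block of [a] in [y] already lies in
   the block of [a] in [x].  Hence merging the blocks of [a] and [b] in [x] creates no
   crossing, and it gives the unique cover of [x] below [y] with the smallest label.
   Iterating, a chain ascending outside a set [S] of its elements precedes
   lexicographically all chains through [S]: for [S] empty this is the EL-property,
   and in general it yields the shelling.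

   Increasing forests, and NBC sets of a perfectly labeled graph, are the edge sets in
   which no vertex is the larger endpoint of two edges.  Sending such a noncrossing set
   to the bond it spans partitions those inside [H] by the noncrossing bonds below [H].
   They form a cone over the colex-smallest edge of [H], so their signed count vanishes
   for nonempty [H]; this is the recursion defining the Moebius function. *)
From mathcomp Require Import all_boot all_order all_algebra.
From mathcomp Require Import zify.
Require Import Defs.
Set Implicit Arguments. Unset Strict Implicit. Unset Printing Implicit Defensive.
Import GRing.Theory.

(** * Larger endpoints, connectivity and the bond spanned by an edge set *)

Definition tops {n : nat} (X : {set edge n}) : {set 'I_n} := [set e.2 | e in X].

(** For [X] inside [G] this is the smallest bond containing [X], with the same components as [X]. *)
Definition cl {n : nat} (G X : {set edge n}) : {set edge n} :=
  [set e in G | conn X e.1 e.2].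

Lemma topsP n (X : {set edge n}) v :
  reflect (exists u, (u, v) \in X) (v \in tops X).
Proof.
apply: (iffP imsetP) => [[[u w] eX /= ->]|[u uvX]]; first by exists u.
by exists (u, v).
Qed.

Lemma tops_sub n (X Y : {set edge n}) : X \subset Y -> tops X \subset tops Y.
Proof. exact: imsetS. Qed.

Lemma simple_sub n (X Y : {set edge n}) :
  X \subset Y -> simple_graph Y -> simple_graph X.
Proof. by move=> /subsetP sXY sY e /sXY/sY. Qed.

Lemma adj_sym n (X : {set edge n}) : symmetric (adj X).
Proof. by move=> x y; rewrite /adj orbC. Qed.

Lemma conn_sym n (X : {set edge n}) x y : conn X x y = conn X y x.
Proof. exact: (sym_connect_sym (@adj_sym n X)). Qed.

Lemma conn0 n (X : {set edge n}) x : conn X x x.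
Proof. exact: connect0. Qed.

Lemma conn_trans n (X : {set edge n}) y x z : conn X x y -> conn X y z -> conn X x z.
Proof. exact: connect_trans. Qed.

Lemma conn_edge n (X : {set edge n}) e : e \in X -> conn X e.1 e.2.
Proof. by case: e => u v uvX; apply: connect1; rewrite /adj uvX. Qed.

Lemma conn_ind n (X : {set edge n}) (P : pred 'I_n) :
  (forall e, e \in X -> P e.1 = P e.2) -> forall x y, conn X x y -> P x = P y.
Proof.
move=> PX x y; apply: (@closed_connect _ (adj X) P) => u v.
by rewrite unfold_in /adj => /orP[/PX|/PX].
Qed.

Lemma conn_min n (X Y : {set edge n}) :
  (forall e, e \in X -> conn Y e.1 e.2) -> forall x y, conn X x y -> conn Y x y.
Proof.
move=> XY x y /(conn_ind (P := conn Y x)) <-; first exact: conn0.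
move=> e /XY eY; apply/idP/idP => [xe|xe]; apply: conn_trans xe _ => //.
by rewrite conn_sym.
Qed.

Lemma conn_sub n (X Y : {set edge n}) : X \subset Y -> forall x y, conn X x y -> conn Y x y.
Proof. by move=> /subsetP sXY; apply: conn_min => e /sXY; apply: conn_edge. Qed.

Lemma subset_cl n (G X : {set edge n}) : X \subset G -> X \subset cl G X.
Proof. by move=> /subsetP sXG; apply/subsetP => e eX; rewrite inE sXG //= conn_edge. Qed.

Lemma cl_sub n (G X : {set edge n}) : cl G X \subset G.
Proof. by apply/subsetP => e; rewrite inE => /andP[]. Qed.

Lemma conn_cl n (G X : {set edge n}) :
  X \subset G -> forall x y, conn (cl G X) x y = conn X x y.
Proof.
move=> sXG x y; apply/idP/idP; last by apply: conn_sub; apply: subset_cl.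
by apply: conn_min => e; rewrite inE => /andP[].
Qed.

Lemma bond_cl n (G X : {set edge n}) : X \subset G -> bond G (cl G X).
Proof.
move=> sXG; rewrite /bond cl_sub; apply/forall_inP => e eG.
by rewrite conn_cl // inE eG; apply/implyP.
Qed.

Lemma cl_bond n (G H : {set edge n}) : bond G H -> cl G H = H.
Proof.
case/andP=> sHG /forall_inP bH; apply/eqP; rewrite eqEsubset subset_cl // andbT.
by apply/subsetP => e; rewrite inE => /andP[eG]; apply/implyP/bH.
Qed.

Lemma bond_simple n (G H : {set edge n}) : bond G H -> simple_graph G -> simple_graph H.
Proof. by case/andP=> sHG _; apply: simple_sub. Qed.

Lemma bond_mem n (G H : {set edge n}) e : bond G H -> e \in G -> conn H e.1 e.2 -> e \in H.
Proof. by move=> bH eG c; rewrite -(cl_bond bH) inE eG. Qed.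

Lemma cl_min n (G X H : {set edge n}) : bond G H -> X \subset H -> cl G X \subset H.
Proof.
move=> bH sXH; apply/subsetP => e; rewrite inE => /andP[eG c].
by apply: (bond_mem bH) => //; apply: conn_sub c.
Qed.

(** * Components of perfectly labeled graphs and their minima *)

Lemma bond_perfectly_labeled n (G H : {set edge n}) :
  bond G H -> perfectly_labeled G -> perfectly_labeled H.
Proof.
move=> bH pG i j k ltijk ik jk; have [/subsetP sHG _] := andP bH.
apply: (bond_mem bH) => /=; first by apply: (pG i j k) => //; apply: sHG.
by apply: conn_trans (conn_edge ik) _; rewrite conn_sym (conn_edge jk).
Qed.

(* Two edges leading down from a common vertex close up to a triangle, so the
   set of vertices from which one can descend to [v] is a union of components. *)
Lemma conn_tops n (X : {set edge n}) u v :
  simple_graph X -> perfectly_labeled X -> conn X u v -> u < v -> v \in tops X.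
Proof.
move=> sX pX cuv ltuv; apply: contraT => /topsP vtop.
pose down : rel 'I_n := fun x y => (y, x) \in X.
(* Induction on a bound for the top [y]. If [w] is the next vertex of the descent from [y], the
   triangle on [w], [x], [y] gives either a step down from [x] to [w], or an edge from [x] up to the
   lower top [w]. *)
have down_closed m : forall x y : 'I_n, y <= m -> (x, y) \in X ->
    connect down y v -> connect down x v.
  elim: m => [|m IHm] x y lym xyX /connectP[[|w p] /=].
  - by move/sX: xyX => /= H; lia.
  - by move/sX: xyX => /= H; lia.
  - by move=> _ vy; case: vtop; exists x; rewrite vy.
  case/andP=> wyX pw vE; have cwv : connect down w v by apply/connectP; exists p.
  have ltwy := sX _ wyX; have ltxy := sX _ xyX; rewrite /= in ltwy ltxy.
  have [ltwx|ltxw|/val_inj<-//] := ltngtP w x.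
    by apply: connect_trans cwv; apply: connect1; apply: (pX _ _ y) => //; rewrite ltwx.
  by apply: (IHm _ w) => //; [lia | apply: (pX _ _ y) => //; rewrite ltxw].
have /= Pv := @conn_ind _ X (fun x => connect down x v) _ _ _ cuv.
have: connect down u v.
  rewrite Pv ?connect0 // => -[x y] xyX /=; apply/idP/idP.
    by move=> cx; apply: connect_trans cx; apply: connect1.
  exact: down_closed xyX.
case/connectP => p; elim: p u {cuv Pv} ltuv => /= [|w p IHp] u ltuv.
  by move=> _ E; rewrite E ltnn in ltuv.
by case/andP=> /sX /= ltwu pw vE; apply: (IHp w) => //; lia.
Qed.

Lemma root_exists n (X : {set edge n}) x :
  simple_graph X -> exists2 r, r \notin tops X & conn X r x.
Proof.
move=> sX; have [m] := ubnP (nat_of_ord x); elim: m x => // m IHm x ltxm.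
have [/topsP[w wxX]|] := boolP (x \in tops X); last by exists x; rewrite ?conn0.
have /= ltwx := sX _ wxX; have [|r rtop crw] := IHm w; first by lia.
by exists r => //; apply: conn_trans crw (conn_edge wxX).
Qed.

Lemma root_unique n (X : {set edge n}) r s :
  simple_graph X -> perfectly_labeled X ->
  r \notin tops X -> s \notin tops X -> conn X r s -> r = s.
Proof.
move=> sX pX rtop stop crs; apply: val_inj; have [ltrs|ltsr|//] := ltngtP r s.
  by rewrite (conn_tops sX pX crs) in stop.
by rewrite conn_sym in crs; rewrite (conn_tops sX pX crs) in rtop.
Qed.

Lemma cc_tops n (X : {set edge n}) :
  simple_graph X -> perfectly_labeled X -> n - cc X = #|tops X|.
Proof.
move=> sX pX; have -> : cc X = #|~: tops X|; last first.
  by have := cardsC (tops X); rewrite card_ord => E; rewrite -[X in X - _]E addnK.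
pose blk x := [set y | conn X x y].
rewrite -(@card_in_imset _ _ blk (mem (~: tops X))); last first.
  move=> r s; rewrite !inE => rtop stop E; apply: (root_unique sX pX) => //.
  by have : s \in blk s by [rewrite inE conn0]; rewrite -E inE.
apply: eq_card => B; apply/imsetP/imsetP => [[x _ ->]|[x _ ->]]; last by exists x.
have [r rtop crx] := root_exists x sX; exists r; rewrite ?inE //.
apply/setP => y; rewrite !inE; apply/idP/idP; first exact: conn_trans.
by apply: conn_trans; rewrite conn_sym.
Qed.

(** A root of [X] is still a root of [Y], and a component of [Y] has only one root; so no two
    components of [X] are joined in [Y]. *)
Lemma conn_eq_tops n (X Y : {set edge n}) :
  simple_graph Y -> perfectly_labeled Y -> X \subset Y -> tops Y \subset tops X ->
  forall x y, conn X x y = conn Y x y.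
Proof.
move=> sY pY sXY /subsetP tYX x y; apply/idP/idP; first exact: conn_sub.
move=> cxy; have sX := simple_sub sXY sY.
have [r rtop crx] := root_exists x sX; have [s stop csy] := root_exists y sX.
suff rs : r = s by apply: (@conn_trans _ _ r); [rewrite conn_sym | rewrite rs].
apply: (root_unique sY pY); try exact: contra (tYX _) _.
apply: conn_trans (conn_sub sXY crx) _.
by apply: conn_trans cxy _; rewrite conn_sym (conn_sub sXY).
Qed.

Lemma tops_cl n (G X : {set edge n}) :
  X \subset G -> simple_graph G -> perfectly_labeled X -> tops (cl G X) = tops X.
Proof.
move=> sXG sG pX; apply/eqP; rewrite eqEsubset (tops_sub (subset_cl sXG)) andbT.
apply/subsetP => v /topsP[u]; rewrite inE => /andP[/sG /= ltuv c].
exact: conn_tops (simple_sub sXG sG) pX c ltuv.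
Qed.

(** Equal tops would force equal components, and a bond is determined by its components. Hence
    counting tops gives a strictly monotone function on bonds. *)
Lemma bond_tops_lt n (G x y : {set edge n}) :
  simple_graph G -> perfectly_labeled G -> bond G x -> bond G y ->
  x \proper y -> #|tops x| < #|tops y|.
Proof.
move=> sG pG bx by_ pxy; rewrite proper_card // properE (tops_sub (proper_sub pxy)).
apply/negP => tyx.
case/andP: pxy => sxy /negP[]; rewrite -(cl_bond bx) -(cl_bond by_).
apply/subsetP => e; rewrite !inE => /andP[->].
rewrite (conn_eq_tops _ _ sxy tyx) //; first exact: bond_simple sG.
exact: bond_perfectly_labeled pG.
Qed.

(** * Noncrossing edge sets and increasing forests *)

Lemma noncrossing_compsP n (H : {set edge n}) :
  reflect (forall a b c d : 'I_n, a < b -> b < c -> c < d ->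
             conn H a c -> conn H b d -> conn H a b)
          (noncrossing_comps H).
Proof.
apply: (iffP idP) => [/forallP nc a b c d ab bc cd ac bd|nc].
  have /forallP/(_ b)/forallP/(_ c)/forallP/(_ d)/implyP := nc a.
  by apply; rewrite ab bc cd ac bd.
apply/forallP => a; apply/forallP => b; apply/forallP => c; apply/forallP => d.
by apply/implyP => /and4P[/andP[ab bc] cd ac bd]; exact: (nc a b c d).
Qed.

Lemma noncrossing_edgesP n (F : {set edge n}) :
  reflect (forall u v x y, (u, v) \in F -> (x, y) \in F -> ~~ ((u < x) && (x < v < y)))
          (noncrossing_edges F).
Proof.
apply: (iffP idP) => [nc u v x y uv xy|nc].
  have /forall_inP/(_ _ xy) := forall_inP nc _ uv.
  by rewrite /crossb negb_or => /andP[].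
apply/forall_inP => -[u v] uv; apply/forall_inP => -[x y] xy.
by rewrite /crossb negb_or /= nc //= nc.
Qed.

Lemma noncrossing_edges_sub n (E F : {set edge n}) :
  E \subset F -> noncrossing_edges F -> noncrossing_edges E.
Proof.
move=> /subsetP sEF /noncrossing_edgesP nc; apply/noncrossing_edgesP.
by move=> u v x y /sEF uv /sEF; apply: nc.
Qed.

(** The component of [b] avoids [u] and [v], and none of its edges crosses [uv], so it cannot pass
    between the inside and the outside of the interval. *)
Lemma noncrossing_edge_side n (F : {set edge n}) u v b d :
  simple_graph F -> noncrossing_edges F -> (u, v) \in F -> ~~ conn F b u -> conn F b d ->
  (u < b < v) = (u < d < v).
Proof.
move=> sF /noncrossing_edgesP nc uvF nbu cbd.
have nbv : ~~ conn F b v.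
  by apply: contra nbu => c; apply: conn_trans c _; rewrite conn_sym (conn_edge uvF).
suff: conn F b b && (u < b < v) = conn F b d && (u < d < v) by rewrite conn0 cbd.
apply: (@conn_ind _ _ (fun x => conn F b x && (u < x < v)) _ _ _ cbd) => -[x y] xyF /=.
have /= ltxy := sF _ xyF; have /= ltuv := sF _ uvF.
have -> : conn F b x = conn F b y.
  apply/idP/idP => c; apply: conn_trans c _; last rewrite conn_sym; exact: conn_edge xyF.
have [cby /=|//] := boolP (conn F b y).
have cbx : conn F b x by apply: conn_trans cby _; rewrite conn_sym (conn_edge xyF).
have neq (w z : 'I_n) : conn F b w -> ~~ conn F b z -> (w : nat) <> z.
  by move=> cw /negP nz /val_inj E; apply: nz; rewrite -E.
have := nc _ _ _ _ uvF xyF; have := nc _ _ _ _ xyF uvF.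
have := neq _ _ cbx nbu; have := neq _ _ cbx nbv.
have := neq _ _ cby nbu; have := neq _ _ cby nbv.
lia.
Qed.

(** If the components differ, each edge of the component of [a] has [b] and [d] on the same side, so
    both its ends lie inside or both outside the interval from [b] to [d]. A walk from [a] (outside)
    to [c] (inside) is then impossible. *)
Lemma noncrossing_edges_comps n (F : {set edge n}) :
  simple_graph F -> noncrossing_edges F -> noncrossing_comps F.
Proof.
move=> sF nF; apply/noncrossing_compsP => a b c d ltab ltbc ltcd cac cbd.
apply: contraT => nab.
suff: conn F a a && (b < a < d) = conn F a c && (b < c < d).
  by rewrite cac conn0; lia.
apply: (@conn_ind _ _ (fun x => conn F a x && (b < x < d)) _ _ _ cac) => -[x y] xyF /=.
have -> : conn F a x = conn F a y.
  apply/idP/idP => k; apply: conn_trans k _; last rewrite conn_sym; exact: conn_edge xyF.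
have [cay /=|//] := boolP (conn F a y).
have cax : conn F a x by apply: conn_trans cay _; rewrite conn_sym (conn_edge xyF).
have neq w z : conn F a w -> conn F b z -> (w : nat) <> z.
  move=> caw cbz /val_inj E; case/negP: nab; apply: conn_trans caw _.
  by rewrite E conn_sym.
have nbx : ~~ conn F b x by apply/negP => /(neq x x cax).
have := noncrossing_edge_side sF nF xyF nbx cbd; have /= := sF _ xyF.
have := neq _ _ cax cbd; have := neq _ _ cay cbd.
have := neq _ _ cax (conn0 F b); have := neq _ _ cay (conn0 F b).
lia.
Qed.

Lemma noncrossing_comps_conn n (X Y : {set edge n}) :
  (forall x y, conn X x y = conn Y x y) -> noncrossing_comps X -> noncrossing_comps Y.
Proof.
move=> E /noncrossing_compsP nc; apply/noncrossing_compsP => a b c d.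
by rewrite -!E; apply: nc.
Qed.

Lemma ncbond_cl n (G X : {set edge n}) :
  X \subset G -> noncrossing_comps X -> ncbond G (cl G X).
Proof.
move=> sXG nc; rewrite /ncbond bond_cl //=.
by apply: noncrossing_comps_conn nc => x y; rewrite conn_cl.
Qed.

(** The local form shared by increasing forests ([isfE]) and NBC sets ([nbcE]). *)
Definition incf {n : nat} (F : {set edge n}) : bool :=
  [forall e in F, forall f in F, (e.2 == f.2) ==> (e == f)].

Lemma incfP n (F : {set edge n}) :
  reflect (forall u w v, (u, v) \in F -> (w, v) \in F -> u = w) (incf F).
Proof.
apply: (iffP idP) => [iF u w v uv wv|iF].
  have /forall_inP/(_ _ wv) := forall_inP iF _ uv.
  by rewrite eqxx => /eqP[].
apply/forall_inP => -[u v] uv; apply/forall_inP => -[w x] /= wx.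
by apply/implyP => /eqP E; rewrite -E in wx *; rewrite (iF _ _ _ uv wx).
Qed.

Lemma incf_sub n (E F : {set edge n}) : E \subset F -> incf F -> incf E.
Proof.
move=> /subsetP sEF /incfP iF; apply/incfP => u w v /sEF uv /sEF; exact: iF uv.
Qed.

(** Holds vacuously, and makes the results on tops available for forests. *)
Lemma incf_perfectly_labeled n (F : {set edge n}) : incf F -> perfectly_labeled F.
Proof.
move=> /incfP iF i j k /andP[ltij _] ik jk.
by move: ltij; rewrite (iF _ _ _ ik jk) ltnn.
Qed.

Lemma card_tops_incf n (F : {set edge n}) : incf F -> #|tops F| = #|F|.
Proof.
move=> /incfP iF; apply: card_in_imset => -[u v] [w x] uv wx /= E.
by rewrite -E in wx *; rewrite (iF _ _ _ uv wx).
Qed.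

(** * Colexicographic keys *)

Lemma colex_lt_total n (e f : edge n) : ~~ colex_lt e f -> ~~ colex_lt f e -> e = f.
Proof.
case: e f => [a b] [c d]; rewrite /colex_lt /= => H1 H2.
by congr (_, _); apply: val_inj => /=; move: H1 H2; rewrite -!val_eqE /=; lia.
Qed.

Lemma colex_key_inj n : injective (@colex_key n).
Proof. by move=> e f E; apply: colex_lt_total; rewrite colex_ltE E ltnn. Qed.

Lemma colex_key_top n (e f : edge n) : colex_key e <= colex_key f -> e.2 <= f.2.
Proof. by rewrite leqNgt -colex_ltE /colex_lt negb_or -leqNgt => /andP[]. Qed.

(** * Merging two blocks along the smallest edge *)

(** Descending from a vertex below [b] to its root in [y] uses only edges with top below [b], which
    all lie in [x]. Vertices in one block of [y] reach the same root. *)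
Lemma conn_below n (x y : {set edge n}) (b u v : 'I_n) :
  simple_graph y -> perfectly_labeled y -> x \subset y ->
  (forall f, f \in y -> f.2 < b -> f \in x) ->
  u < b -> v < b -> conn y u v -> conn x u v.
Proof.
move=> sy py sxy below ltub ltvb cuv.
have root (w : 'I_n) : w < b -> exists2 r, r \notin tops y & conn x r w.
  have [m] := ubnP (nat_of_ord w); elim: m w => // m IHm w ltwm ltwb.
  have [/topsP[t twy]|] := boolP (w \in tops y); last by exists w; rewrite ?conn0.
  have /= lttw := sy _ twy; have [||r rtop crt] := IHm t; [lia | lia |].
  by exists r => //; apply: conn_trans crt (conn_edge (below _ twy ltwb)).
have [r rtop cru] := root _ ltub; have [s stop csv] := root _ ltvb.
suff rs : r = s by apply: (@conn_trans _ _ r); [rewrite conn_sym | rewrite rs].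
apply: (root_unique sy py) => //; apply: conn_trans (conn_sub sxy cru) _.
by apply: conn_trans cuv _; rewrite conn_sym (conn_sub sxy).
Qed.

Lemma conn_setU1 n (x : {set edge n}) a b u v :
  conn ((a, b) |: x) u v ->
  conn x u v \/ (conn x a u || conn x b u) && (conn x a v || conn x b v).
Proof.
pose P w := conn x a w || conn x b w.
have Pconn w t : conn x w t -> P w = P t.
  move=> cwt; apply/orP/orP => -[]c; [left|right|left|right]; apply: conn_trans c _ => //.
    by rewrite conn_sym.
  by rewrite conn_sym.
(* Invariant along edges: [w] is in the [x]-block of [u], or [u] and [w] both lie in the merged
   block [P]. *)
move=> cuv; have: conn x u u || P u && P u by rewrite conn0.
rewrite (@conn_ind _ _ (fun w => conn x u w || P u && P w) _ _ _ cuv).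
  by case/orP; [left|right].
have Pa : P a by rewrite /P conn0.
have Pb : P b by rewrite /P conn0 orbT.
move=> e; rewrite in_setU1 => /orP[/eqP-> /=|/conn_edge ce].
  rewrite Pa Pb andbT; have [Pu|/negP nPu] := boolP (P u); rewrite ?orbT ?orbF //.
  by apply/idP/idP => /Pconn Pua; case: nPu; rewrite Pua.
rewrite (Pconn _ _ ce); congr (_ || _); apply/idP/idP => c; apply: conn_trans c _ => //.
by rewrite conn_sym.
Qed.

Section Merge.
Variables (n : nat) (G x y : {set edge n}) (a b : 'I_n).
Hypotheses (sG : simple_graph G) (pG : perfectly_labeled G).
Hypotheses (ncx : ncbond G x) (ncy : ncbond G y) (sxy : x \subset y).
Hypotheses (aby : (a, b) \in y) (abx : (a, b) \notin x).
Hypothesis abmin : forall f, f \in y :\: x -> colex_key (a, b) <= colex_key f.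

Let bx : bond G x := proj1 (andP ncx).
Let by_ : bond G y := proj1 (andP ncy).
Let sy : simple_graph y := bond_simple by_ sG.
Let py : perfectly_labeled y := bond_perfectly_labeled by_ pG.
Let z := cl G ((a, b) |: x).
Let ltab : a < b := sy aby.
Let abG : (a, b) \in G := subsetP (proj1 (andP by_)) _ aby.
Let sXy : (a, b) |: x \subset y.
Proof. by rewrite subUset sub1set aby. Qed.
Let sXG : (a, b) |: x \subset G := subset_trans sXy (proj1 (andP by_)).

Let below (v : 'I_n) : v < b -> conn y a v -> conn x a v.
Proof.
move=> ltvb; apply: (conn_below (b := b)) => // f fy ltfb; apply: contraT => nfx.
by have := @abmin f; rewrite inE nfx fy => /(_ isT) /colex_key_top; rewrite leqNgt ltfb.
Qed.

Let nab : ~~ conn x a b.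
Proof. by apply: contra abx => c; apply: (bond_mem bx). Qed.

(** The lower end [c] of such an edge would be below [b] in the [y]-block of [a], hence in the
    [x]-block of [a], joining [a] to [b] in [x]. So [b] is the one new top of the merge, and the
    enlarged edge set stays perfectly labeled. *)
Let btop : b \notin tops x.
Proof.
apply/topsP => -[c cbx]; have cby := subsetP sxy _ cbx; case/negP: nab.
apply: conn_trans (conn_edge cbx); apply: below; first exact: (sy cby).
by apply: conn_trans (conn_edge aby) _; rewrite conn_sym (conn_edge cby).
Qed.

Let pX : perfectly_labeled ((a, b) |: x).
Proof.
move=> i j k ltijk; rewrite !in_setU1 => /predU1P[[ia kb]|ik] /predU1P[[ja kb']|jk].
- by move: ltijk; rewrite ia ja ltnn.
- by case/negP: btop; apply/topsP; exists j; rewrite -kb.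
- by case/negP: btop; apply/topsP; exists i; rewrite -kb'.
- by rewrite (bond_perfectly_labeled bx pG ltijk ik jk) orbT.
Qed.

Lemma merge_tops : #|tops z| = #|tops x|.+1.
Proof.
rewrite tops_cl // -(_ : b |: tops x = tops ((a, b) |: x)) ?cardsU1 ?btop //.
by rewrite /tops imsetU1.
Qed.

Lemma merge_sub : z \subset y.
Proof. exact: cl_min. Qed.

(* If merging the blocks of [a] and [b] created a crossing with a third block,
   that block would lie in the same block of [y], hence entirely above [b], and
   would already cross the block of [a] or that of [b]. *)
Lemma merge_ncbond : ncbond G z.
Proof.
apply: ncbond_cl => //; apply/noncrossing_compsP => p q r s ltpq ltqr ltrs.
have /noncrossing_compsP nx := proj2 (andP ncx).
have /noncrossing_compsP ny := proj2 (andP ncy).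
have cX u v : conn x u v -> conn ((a, b) |: x) u v by apply: conn_sub; apply: subsetUr.
have cXy u v : conn ((a, b) |: x) u v -> conn y u v by apply: conn_sub.
have cab : conn ((a, b) |: x) a b by apply: (@conn_edge _ _ (a, b)); rewrite setU11.
pose P w := conn x a w || conn x b w.
have PX w : P w -> conn ((a, b) |: x) a w.
  by case/orP=> /cX // c; apply: conn_trans cab c.
have PXX w t : P w -> P t -> conn ((a, b) |: x) w t.
  by move=> /PX Pw /PX Pt; apply: conn_trans Pt; rewrite conn_sym.
have above w : conn y a w -> ~~ P w -> b < w.
  rewrite negb_or => cyw /andP[naw nbw]; have [ltwb|//|/val_inj E] := ltngtP w b.
    by rewrite below in naw.
  by rewrite E conn0 in nbw.
move=> cpr cqs; have cpq : conn y p q by apply: ny (cXy _ _ cpr) (cXy _ _ cqs).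
case: (conn_setU1 cpr) => [xpr|/andP[Pp Pr]]; case: (conn_setU1 cqs) => [xqs|/andP[Pq Ps]].
- exact/cX/(nx p q r s).
- have [Pp|nPp] := boolP (P p); first exact: PXX.
  have ltbp : b < p.
    apply: above => //; apply: conn_trans (cXy _ _ (PX _ Pq)) _.
    by rewrite conn_sym.
  case/negP: nPp; rewrite /P; case/orP: Pq => c; apply/orP; [left|right].
    by apply: (nx _ _ q r) => //; apply: ltn_trans ltbp.
  by apply: (nx _ _ q r).
- have [Pq|nPq] := boolP (P q); first exact: PXX.
  have ltbq : b < q by apply: above => //; apply: conn_trans (cXy _ _ (PX _ Pp)) _.
  case/negP: nPq; rewrite /P; case/orP: Pr => c; apply/orP; [left|right].
    by apply: (nx _ _ r s) => //; apply: ltn_trans ltbq.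
  by apply: (nx _ _ r s).
- exact: PXX.
Qed.

End Merge.

(** * The minimum labeling *)

(** Keys stay below [n * n], so the default value in [lab] never beats an actual edge. *)
Lemma colex_key_lt n (e : edge n) : colex_key e < n * n.
Proof. by rewrite /colex_key; have := ltn_ord e.1; have := ltn_ord e.2; nia. Qed.

Lemma lab_le n (x y : {set edge n}) e : e \in y :\: x -> lab x y <= colex_key e.
Proof.
rewrite /lab => eyx; have: e \in index_enum (edge n) by rewrite mem_index_enum.
elim: (index_enum _) => // f r IHr; rewrite big_cons in_cons => /predU1P[<-|/IHr le_e].
  by rewrite eyx geq_minl.
by case: ifP => // _; apply: leq_trans (geq_minr _ _) le_e.
Qed.

Lemma lab_ge n (x y : {set edge n}) m :
  m <= n * n -> (forall e, e \in y :\: x -> m <= colex_key e) -> m <= lab x y.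
Proof.
move=> le_m le_e; apply: (big_ind (fun k => m <= k)) => // k l mk ml.
by rewrite leq_min mk.
Qed.

Lemma labP n (x y : {set edge n}) :
  x \proper y -> exists2 e, e \in y :\: x & lab x y = colex_key e.
Proof.
case/properP=> _ [f fy fx]; have fyx : f \in y :\: x by rewrite inE fx.
case: (arg_minnP (@colex_key n) fyx) => e eyx emin.
by exists e => //; apply/eqP; rewrite eqn_leq lab_le // lab_ge // ltnW ?colex_key_lt.
Qed.

Lemma coverP n (G x y : {set edge n}) :
  reflect [/\ ncbond G x, ncbond G y, x \proper y &
              forall z, ncbond G z -> x \proper z -> z \subset y -> z = y]
          (cover G x y).
Proof.
apply: (iffP and4P) => -[ncx ncy pxy H]; split=> //.
  move=> z ncz pxz szy; apply/eqP; apply: contraNT H => nzy.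
  by apply/existsP; exists z; rewrite ncz pxz properEneq nzy.
apply/negP => /existsP[z /and3P[ncz pxz pzy]].
by have := pzy; rewrite (H z ncz pxz (proper_sub pzy)) properxx.
Qed.

Lemma cover_proper n (G x y : {set edge n}) : cover G x y -> x \proper y.
Proof. by case/coverP. Qed.

Lemma cover_path_sub n (G x : {set edge n}) s :
  path (cover G) x s -> forall z, z \in s -> (x \proper z) && (z \subset last x s).
Proof.
elim: s x => //= x1 s IHs x /andP[/cover_proper pxx1 p1] z.
have [/eqP|s_n0] := boolP (s == [::]).
  by move=> ->; rewrite inE => /eqP->; rewrite pxx1 /=.
have [w ws] : exists w, w \in s by case: (s) s_n0 => // w; exists w; rewrite mem_head.
have /andP[p1w swl] := IHs _ p1 _ ws.
rewrite in_cons => /predU1P[->|/(IHs _ p1)/andP[p1z ->]].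
  by rewrite pxx1 (subset_trans (proper_sub p1w)).
by rewrite (proper_trans pxx1 p1z).
Qed.

Lemma path_cover_last n (G x : {set edge n}) s : path (cover G) x s -> x \subset last x s.
Proof.
by case: s => // x1 s p; have /andP[/proper_sub sx1 /(subset_trans sx1)] :=
  cover_path_sub p (mem_head _ _).
Qed.

Lemma path_cover_nil n (G x : {set edge n}) s : path (cover G) x s -> last x s = x -> s = [::].
Proof.
case: s => // x1 s p lx; have := cover_path_sub p (mem_head _ _).
by rewrite lx andbC => /andP[/sub_proper_trans H /H]; rewrite properxx.
Qed.

Lemma path_cover_ncbond n (G x : {set edge n}) s w :
  path (cover G) x s -> w \in s -> ncbond G w.
Proof.
elim: s x => //= x1 s IHs x /andP[/coverP[_ ncx1 _ _] /IHs ws].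
by rewrite in_cons => /predU1P[-> //|].
Qed.

(** The witness is the merge along the least edge [ab] of [y] outside [x]. It adds a single top,
    which leaves no room below it, so it is a cover. A cover inside [y] with label at most that of
    [z] must contain [ab], hence [z]. *)
Lemma min_cover n (G x y : {set edge n}) :
  simple_graph G -> perfectly_labeled G -> ncbond G x -> ncbond G y -> x \proper y ->
  exists z, [/\ cover G x z, z \subset y, #|tops z| = #|tops x|.+1,
    forall f, f \in y :\: x -> lab x z <= colex_key f &
    forall w, cover G x w -> w \subset y -> lab x w <= lab x z -> w = z].
Proof.
move=> sG pG ncx ncy pxy; have sxy := proper_sub pxy; have bx := proj1 (andP ncx).
case: (labP pxy) => -[a b] abyx labE.
have /setDP[aby abx] := abyx.
have abmin f : f \in y :\: x -> colex_key (a, b) <= colex_key f by rewrite -labE; apply: lab_le.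
have ncz := merge_ncbond sG pG ncx ncy sxy aby abmin.
have szy := merge_sub ncy sxy aby.
have tz := merge_tops sG pG ncx ncy sxy aby abx abmin.
have sz : (a, b) |: x \subset cl G ((a, b) |: x).
  apply: subset_cl; apply: subset_trans (proj1 (andP (proj1 (andP ncy)))).
  by rewrite subUset sub1set aby.
have zmin w : ncbond G w -> x \subset w -> (a, b) \in w -> cl G ((a, b) |: x) \subset w.
  by move=> /andP[bw _] sxw abw; apply: cl_min; rewrite // subUset sub1set abw.
move: (cl G ((a, b) |: x)) ncz szy tz sz zmin => z ncz szy tz sz zmin.
have bz := proj1 (andP ncz).
have abz : (a, b) \in z by rewrite (subsetP sz) ?setU11.
have sxz : x \subset z := subset_trans (subsetUr _ _) sz.
have pxz : x \proper z by apply/properP; split=> //; exists (a, b).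
have labz : lab x z = colex_key (a, b).
  apply/eqP; rewrite eqn_leq lab_le /=; last by apply/setDP.
  apply: lab_ge => [|f /setDP[fz fx]]; first exact: ltnW (colex_key_lt _).
  by apply: abmin; rewrite inE fx (subsetP szy).
exists z; split=> //; first (apply/coverP; split=> // w ncw pxw swz).
- apply/eqP; rewrite eqEproper swz; apply/negP => pwz.
  have := bond_tops_lt sG pG (proj1 (andP ncw)) bz pwz.
  by rewrite tz ltnS leqNgt (bond_tops_lt sG pG bx (proj1 (andP ncw)) pxw).
- by move=> f /abmin; rewrite labz.
- move=> w /coverP[_ ncw pxw wmin] swy; case: (labP pxw) => f fwx -> lewz.
  have /setDP[fw fx] := fwx.
  have fE : f = (a, b).
    apply: colex_key_inj; apply/eqP; rewrite eqn_leq -{1}labz lewz abmin //.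
    by rewrite inE fx (subsetP swy).
  by symmetry; apply: wmin => //; apply: zmin; rewrite ?proper_sub -?fE.
Qed.

(** The merge inside a cover [y] is all of [y]; so every cover adds exactly one top, which yields
    the grading. *)
Lemma cover_tops n (G x y : {set edge n}) :
  simple_graph G -> perfectly_labeled G -> cover G x y -> #|tops y| = #|tops x|.+1.
Proof.
move=> sG pG /coverP[ncx ncy pxy ymin].
have [z [/coverP[_ ncz pxz _] szy tz _ _]] := min_cover sG pG ncx ncy pxy.
by rewrite -(ymin z).
Qed.

Lemma satchain_size n (G x y : {set edge n}) s :
  simple_graph G -> perfectly_labeled G -> satchain G x y s ->
  #|tops y| = #|tops x| + size s.
Proof.
move=> sG pG /andP[p /eqP<-]; elim: s x p => [|x1 s IHs] x /=; first by rewrite addn0.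
by case/andP=> /(cover_tops sG pG) t1 /IHs ->; rewrite t1 addSnnS.
Qed.

(* Strict increase of labels is only required at the elements outside [S]. *)
Fixpoint asc {n : nat} (S : {set {set edge n}}) (x : {set edge n})
    (s : seq {set edge n}) : bool :=
  if s is x1 :: s1 then
    (if s1 is x2 :: _ then (x1 \in S) || (lab x x1 < lab x1 x2) else true) && asc S x1 s1
  else true.

Lemma asc0 n (x : {set edge n}) s : asc set0 x s = sorted ltn (labels x s).
Proof.
case: s => // x1 s; elim: s x x1 => // x2 s IHs x x1.
by rewrite [LHS]/= inE /= -/(asc set0 x1 (x2 :: s)) IHs.
Qed.

Lemma not_asc n (S : {set {set edge n}}) x s : ~~ asc S x s ->
  exists p x1 x2 q,
    [/\ s = p ++ [:: x1, x2 & q], x1 \notin S & lab x1 x2 <= lab (last x p) x1].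
Proof.
elim: s x => [|x1 [|x2 s] IHs] x //; rewrite [asc _ _ _]/=.
rewrite negb_and -/(asc S x1 (x2 :: s)) => /orP[|/IHs[p [y1 [y2 [q [-> nS le]]]]]].
  by rewrite negb_or -leqNgt => /andP[nS le]; exists [::], x1, x2, s.
by exists (x1 :: p), y1, y2, q.
Qed.

(** Take the smallest-label cover repeatedly. The next label belongs to an edge of [y] outside [z],
    so it is at least the current one, and it differs since the edge of the current label lies in
    [z]. *)
Lemma greedy_satchain n (G x y : {set edge n}) :
  simple_graph G -> perfectly_labeled G -> ncbond G x -> ncbond G y -> x \subset y ->
  exists2 s, satchain G x y s & asc set0 x s.
Proof.
move=> sG pG ncx ncy sxy; have [m] := ubnP #|y :\: x|.
elim: m x ncx sxy => // m IHm x ncx sxy ltm.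
have [<-|nxy] := eqVneq x y; first by exists [::]; rewrite /satchain /=.
have pxy : x \proper y by rewrite properEneq nxy.
have [z [cxz szy _ zle _]] := min_cover sG pG ncx ncy pxy.
have [_ ncz pxz _] := coverP _ _ _ cxz; have [sxz [e ez ex]] := properP pxz.
have [|s /andP[ps ls] as_] := IHm z ncz szy.
  rewrite -ltnS; apply: leq_trans ltm; rewrite ltnS; apply: proper_card; apply/properP; split.
    by apply/subsetP => f /setDP[fy fz]; rewrite inE fy andbT (contra (subsetP sxz f)).
  by exists e; rewrite inE ?ez // ex (subsetP szy).
exists (z :: s); first by rewrite /satchain /= cxz ps.
rewrite [asc _ _ _]/= as_ andbT; case: s ps ls {as_} => //= z2 s /andP[czz2 ps] /eqP ls.
have z2y : z2 \subset y by rewrite -ls; apply: path_cover_last ps.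
case: (labP (cover_proper czz2)) => f /setDP[fz2 fz] ->; rewrite inE /=.
rewrite ltn_neqAle zle ?andbT; last by rewrite inE (subsetP z2y) // (contra (subsetP sxz f)).
case: (labP pxz) => g /setDP[gz _] ->; apply: contra fz => /eqP/colex_key_inj <-.
exact: gz.
Qed.

(** The witness [w] is the first element after [x] lying in [S], or the end of the chain. Labels
    increase up to [w], so the first of them is the least key of all edges gained on the way. *)
Lemma asc_first n (G : {set edge n}) S x x1 s :
  path (cover G) x (x1 :: s) -> asc S x (x1 :: s) ->
  exists w, [/\ w \in x1 :: s, (w \in S) || (w == last x1 s) &
                forall e, e \in w :\: x -> lab x x1 <= colex_key e].
Proof.
elim: s x x1 => [|x2 s IHs] x x1 p.
  by move=> _; exists x1; split; rewrite ?mem_head ?eqxx ?orbT // => e; apply: lab_le.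
rewrite [asc _ _ _]/= -/(asc S x1 (x2 :: s)) => /andP[].
have [x1S _ _|nx1S /= lt12] := boolP (x1 \in S).
  by exists x1; split; rewrite ?mem_head ?x1S // => e; apply: lab_le.
move: p; rewrite [path _ _ _]/= -/(path (cover G) x1 (x2 :: s)) => /andP[_ p].
case/(IHs _ _ p) => w [ws wS wle]; exists w; split=> // [|e /setDP[ew ex]].
  by rewrite in_cons ws orbT.
have [ex1|nex1] := boolP (e \in x1); first by rewrite lab_le // inE ex.
by apply: leq_trans (ltnW lt12) _; rewrite wle // inE nex1.
Qed.

(** The chain [t] also passes through the [w] of [asc_first], so its first label is no smaller than
    that of [s]. In case of equality both chains start with the smallest-label cover below [w], and
    the argument repeats from there. *)
Lemma asc_lex_first n (G : {set edge n}) S x s t :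
  simple_graph G -> perfectly_labeled G ->
  path (cover G) x s -> path (cover G) x t -> last x s = last x t ->
  asc S x s -> (forall w, w \in s -> w \in S -> w \in t) ->
  s = t \/ lexlt (labels x s) (labels x t).
Proof.
move=> sG pG; elim: s x t => [|x1 s IHs] x [|y1 t] ps pt.
- by left.
- by move=> /esym /(path_cover_nil pt).
- by move=> /(path_cover_nil ps).
move=> lst ascs St; have [w [ws wS wle]] := asc_first ps ascs.
have wt : w \in y1 :: t.
  by case/orP: wS => [|/eqP->]; [apply: St | move: lst => /= ->; rewrite mem_last].
have sub_w z1 r : path (cover G) x (z1 :: r) -> w \in z1 :: r -> z1 \subset w.
  rewrite in_cons /= => /andP[_ pr] /predU1P[-> //|].
  by case/(cover_path_sub pr)/andP => /proper_sub.
have sx1w := sub_w _ _ ps ws; have sy1w := sub_w _ _ pt wt.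
have /andP[cx1 ps1] := ps; have /andP[cy1 pt1] := pt.
have le1 : lab x x1 <= lab x y1.
  case: (labP (cover_proper cy1)) => f /setDP[fy1 fx] ->.
  by rewrite wle // inE fx (subsetP sy1w).
have [lt1|eq1] : lab x x1 < lab x y1 \/ lab x x1 = lab x y1.
  by move: le1; rewrite leq_eqVlt => /predU1P[]; [right | left].
  by right; rewrite /= lt1.
have [ncx ncx1 _ _] := coverP _ _ _ cx1.
have ncw : ncbond G w.
  exact: path_cover_ncbond ps ws.
have pxw : x \proper w by apply: proper_sub_trans (cover_proper cx1) sx1w.
have [z [cz szw _ _ zuniq]] := min_cover sG pG ncx ncw pxw.
have lez : lab x x1 <= lab x z.
  case: (labP (cover_proper cz)) => f /setDP[fz fx] ->.
  by rewrite wle // inE fx (subsetP szw).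
have x1E : x1 = z by apply: zuniq.
have y1E : y1 = z by apply: zuniq; rewrite // -eq1.
subst y1; subst z; case: (IHs x1 t) => //.
- by move: ascs; rewrite /= => /andP[].
- move=> v vs vS; have: v \in x1 :: t by apply: St; rewrite // in_cons vs orbT.
  rewrite in_cons => /predU1P[E|//]; have := cover_path_sub ps1 vs.
  by rewrite E properxx.
- by move=> ->; left.
- by move=> lt1; right; rewrite /= eqxx lt1 orbT.
Qed.

(** * Lexicographic comparison and the EL-property *)

Lemma lexlt_irr s : lexlt s s = false.
Proof. by elim: s => //= a s ->; rewrite ltnn eqxx. Qed.

Lemma lexlt_trans : transitive lexlt.
Proof.
elim=> [|b t IHt] [|a s] [|c u] //= /orP[ab|/andP[/eqP-> st]] /orP[bc|/andP[/eqP<- tu]].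
- by rewrite (ltn_trans ab bc).
- by rewrite ab.
- by rewrite bc.
- by rewrite eqxx (IHt _ _ st tu) orbT.
Qed.

Lemma lexlt_total s t : [|| s == t, lexlt s t | lexlt t s].
Proof.
elim: s t => [|a s IHs] [|b t] //=; rewrite eqseq_cons.
by have [] := ltngtP a b; rewrite ?orbT //= => _.
Qed.

Lemma satchain_EL n (G : {set edge n}) :
  simple_graph G -> perfectly_labeled G -> EL_min_colex G.
Proof.
move=> sG pG x y ncx ncy sxy.
have [s sat as_] := greedy_satchain sG pG ncx ncy sxy; have /andP[ps /eqP ls] := sat.
have first t : satchain G x y t -> s = t \/ lexlt (labels x s) (labels x t).
  case/andP=> pt /eqP lt; apply: (@asc_lex_first _ G set0) => //; first by rewrite ls.
  by move=> w; rewrite inE.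
exists s; split=> // [|t satt|t satt nts]; first by rewrite -asc0.
- rewrite -asc0 => at_; case: (first t satt) => // lst.
  have /andP[pt /eqP lt] := satt.
  (* Two different ascending chains would each precede the other. *)
  case: (@asc_lex_first _ G set0 x t s) => // [|w|lts]; first by rewrite lt.
    by rewrite inE.
  by have := lexlt_trans lst lts; rewrite lexlt_irr.
- by case: (first t satt) => // E; rewrite E eqxx in nts.
Qed.

(** * Maximal chains and shellability *)

Lemma ncbond0 n (G : {set edge n}) : simple_graph G -> ncbond G set0.
Proof.
move=> sG; have -> : set0 = cl G set0.
  apply/setP => -[u v]; rewrite !inE; apply/esym/negP => /andP[/sG /= ltuv].
  move/(@conn_ind _ _ (pred1 u)) => /= E; move: ltuv; rewrite -(eqP (_ : v == u)) ?ltnn //.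
  by rewrite -E ?eqxx // => e; rewrite inE.
apply: ncbond_cl; first exact: sub0set.
by apply: noncrossing_edges_comps => [e|]; [|apply/noncrossing_edgesP => ? ? ? ?]; rewrite inE.
Qed.

Lemma chainbP n (G : {set edge n}) (C : {set {set edge n}}) :
  reflect ((forall x, x \in C -> ncbond G x) /\
           (forall x y, x \in C -> y \in C -> (x \subset y) || (y \subset x)))
          (chainb G C).
Proof.
apply: (iffP andP) => -[ncC cmpC]; split.
- by move=> x xC; apply: (forall_inP ncC).
- by move=> x y xC yC; apply: (forall_inP (forall_inP cmpC _ xC)).
- exact/forall_inP.
- by apply/forall_inP => x xC; apply/forall_inP => y yC; apply: cmpC.
Qed.

(** The number of tops separates the members of a chain and takes values from 0 to [#|tops H|]. *)
Lemma card_chain n (G : {set edge n}) (C : {set {set edge n}}) (H : {set edge n}) :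
  simple_graph G -> perfectly_labeled G -> chainb G C ->
  (forall x, x \in C -> x \subset H) -> #|C| <= #|tops H|.+1.
Proof.
move=> sG pG /chainbP[ncC cmpC] CH.
have bC x : x \in C -> bond G x by move/ncC => /andP[].
pose f (x : {set edge n}) : 'I_(#|tops H|).+1 := inord #|tops x|.
rewrite -(@card_in_imset _ _ f (mem C)) => [|x y xC yC /(congr1 val)]; last first.
  rewrite /= !inordK ?ltnS ?subset_leq_card ?tops_sub ?CH // => E; apply/eqP.
  apply: contraT => nxy; case/orP: (cmpC x y xC yC) => sub.
    have := bond_tops_lt sG pG (bC _ xC) (bC _ yC).
    by rewrite E ltnn properEneq nxy sub => /(_ isT).
  have := bond_tops_lt sG pG (bC _ yC) (bC _ xC).
  by rewrite E ltnn properEneq eq_sym nxy sub => /(_ isT).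
by rewrite -[X in _ <= X]card_ord max_card.
Qed.

Lemma path_cover_uniq n (G x : {set edge n}) s : path (cover G) x s -> uniq (x :: s).
Proof.
move=> p; apply: (@sorted_uniq _ (fun A B : {set edge n} => A \proper B)).
- by move=> A B C; apply: proper_trans.
- exact: properxx.
- by apply: sub_path p => A B; apply: cover_proper.
Qed.

Lemma path_cover_chainb n (G x : {set edge n}) s :
  ncbond G x -> path (cover G) x s -> chainb G [set z in x :: s].
Proof.
move=> ncx p; apply/chainbP; elim: s x ncx p => [|x1 s IHs] x ncx p.
  by split=> [z|z w]; rewrite !inE => /eqP-> // /eqP->; rewrite subxx.
have /andP[/coverP[_ ncx1 _ _] p1] := p; have [nc1 cmp1] := IHs x1 ncx1 p1.
split=> [z|z w]; rewrite ![_ \in [set _ in _]]inE 1?in_cons.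
  by case/predU1P=> [-> //|zs]; apply: nc1; rewrite inE.
have xsub v : v \in x1 :: s -> x \subset v.
  by case/(cover_path_sub p)/andP => /proper_sub.
rewrite [w \in _]in_cons => /predU1P[->|zs] /predU1P[->|ws]; rewrite ?subxx ?xsub ?orbT //.
by apply: cmp1; rewrite inE.
Qed.

Lemma card_path_cover n (G x : {set edge n}) s :
  path (cover G) x s -> #|[set z in x :: s]| = (size s).+1.
Proof. by move/path_cover_uniq => u; rewrite cardsE (card_uniqP u). Qed.

Lemma rk_tops n (G H : {set edge n}) :
  simple_graph G -> perfectly_labeled G -> ncbond G H -> rk G H = #|tops H|.
Proof.
move=> sG pG ncH; rewrite /rk; set m := \max_(C | _) _.
(* [rk] is one less than the number of elements of a longest chain; the greedy chain from the empty
   bond attains the bound of [card_chain]. *)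
suff -> : m = #|tops H|.+1 by [].
apply/eqP; rewrite eqn_leq; apply/andP; split.
  by apply/bigmax_leqP => C /andP[cC /forall_inP CH]; exact: (card_chain sG pG cC CH).
have nc0 := ncbond0 sG.
have [s sat _] := greedy_satchain sG pG nc0 ncH (sub0set H).
have := satchain_size sG pG sat; rewrite {2}/tops imset0 cards0 add0n => ->.
have /andP[p /eqP l] := sat; rewrite -(card_path_cover p).
apply: (@leq_bigmax_cond _ _ (fun C : {set {set edge n}} => #|C|)).
rewrite path_cover_chainb //=; apply/forall_inP => z; rewrite inE in_cons.
case/predU1P => [->|/(cover_path_sub p)/andP[_]]; [exact: sub0set | by rewrite l].
Qed.

Lemma satchain_maxset n (G : {set edge n}) s :
  simple_graph G -> perfectly_labeled G -> satchain G set0 G s ->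
  maxset (chainb G) [set z in set0 :: s].
Proof.
move=> sG pG sat; have /andP[p _] := sat; apply/maxsetP; split.
  exact: path_cover_chainb (ncbond0 sG) p.
move=> C cC sub; apply/esym/eqP; rewrite eqEcard sub (card_path_cover p).
have := satchain_size sG pG sat; rewrite {2}/tops imset0 cards0 add0n => <-.
apply: (card_chain sG pG cC) => x xC; have [ncC _] := chainbP _ _ cC.
by have /andP[/andP[]] := ncC _ xC.
Qed.

Lemma maxset_chain_mem n (G : {set edge n}) (C : {set {set edge n}}) (w : {set edge n}) :
  maxset (chainb G) C -> ncbond G w ->
  (forall z : {set edge n}, z \in C -> (z \subset w) || (w \subset z)) -> w \in C.
Proof.
case/maxsetP => /chainbP[ncC cmpC] maxC ncw cmpw; rewrite -(maxC (w |: C)) ?subsetUr ?setU11 //.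
apply/chainbP; split=> [z|y z]; rewrite !in_setU1; first by case/predU1P=> [->|/ncC].
case/predU1P=> [->|yC] /predU1P[->|zC]; rewrite ?subxx ?cmpw //; last exact: cmpC.
by rewrite orbC cmpw.
Qed.

(** The next element is one of least cardinality among those of [C] strictly above [x]; by
    maximality of [C] nothing fits in between. The recursion only describes the part of [C] above
    [x]. *)
Lemma maxset_satchain_from n (G : {set edge n}) (C : {set {set edge n}}) (x : {set edge n}) :
  ncbond G G -> maxset (chainb G) C -> x \in C ->
  exists s, satchain G x G s /\
    forall z : {set edge n}, x \subset z -> (z \in C) = (z \in x :: s).
Proof.
move=> ncG maxC; have [/chainbP[ncC cmpC] _] := maxsetP maxC.
have CG (z : {set edge n}) : z \in C -> z \subset G by move/ncC => /andP[/andP[]].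
have GC : G \in C by apply: maxset_chain_mem maxC ncG _ => z /CG ->.
have [m] := ubnP #|G :\: x|; elim: m x => // m IHm x ltm xC.
have [E|nxG] := eqVneq x G.
  exists [::]; rewrite /satchain /= E eqxx; split=> // z sGz; rewrite inE.
  apply/idP/eqP => [/CG szG|-> //]; apply/eqP; rewrite eqEsubset szG; exact: sGz.
have pxG : x \proper G by rewrite properEneq nxG CG.
have GP : (G \in C) && (x \proper G) by rewrite GC.
case: (@arg_minnP _ G (fun z : {set edge n} => (z \in C) && (x \proper z)) (fun z => #|z|) GP).
move=> y /andP[yC pxy] ymin.
have yle (z : {set edge n}) : z \in C -> x \proper z -> y \subset z.
  move=> zC pxz; case/orP: (cmpC _ _ yC zC) => // szy.
  have /eqP-> // : z == y by rewrite eqEcard szy ymin ?zC.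
have cxy : cover G x y.
  apply/coverP; split; rewrite ?ncC // => w ncw pxw swy; apply/eqP; rewrite eqEsubset swy.
  apply: (yle _ _ pxw); apply: maxset_chain_mem maxC ncw _ => z zC.
  case/orP: (cmpC _ _ zC xC) => [szx|sxz].
    by rewrite (subset_trans szx (proper_sub pxw)).
  have [<-|nxz] := eqVneq x z; first by rewrite (proper_sub pxw).
  by rewrite (subset_trans swy) ?orbT // yle // properEneq nxz.
have [|s [/andP[p l] sC]] := IHm y _ yC.
  rewrite -ltnS; apply: leq_trans ltm; rewrite ltnS; apply: proper_card.
  have [sxy [e ey ex]] := properP pxy; apply/properP; split; first exact: setDS.
  by exists e; rewrite inE ?ey // ex (subsetP (CG _ yC)).
exists (y :: s); rewrite /satchain /= cxy p l; split=> // z sxz; rewrite in_cons.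
have [->|nzx] := eqVneq z x; first by rewrite xC.
have pxz : x \proper z by rewrite properEneq eq_sym nzx.
apply/idP/idP => [zC|zs]; first by rewrite -sC // yle.
rewrite sC //; move: zs; rewrite in_cons => /predU1P[-> //|/(cover_path_sub p)].
by case/andP=> /proper_sub.
Qed.

Lemma maxset_satchain n (G : {set edge n}) (C : {set {set edge n}}) :
  simple_graph G -> ncbond G G -> maxset (chainb G) C ->
  exists2 s, satchain G set0 G s & C = [set z in set0 :: s].
Proof.
move=> sG ncG maxC; have C0 : set0 \in C.
  by apply: maxset_chain_mem maxC (ncbond0 sG) _ => z _; rewrite sub0set orbT.
have [s [sat sC]] := maxset_satchain_from ncG maxC C0; exists s => //.
by apply/setP => z; rewrite inE sC ?sub0set.
Qed.

Lemma ncbond_graded n (G : {set edge n}) :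
  simple_graph G -> perfectly_labeled G -> ncbond G G -> graded G.
Proof.
move=> sG pG ncG.
have card (C : {set {set edge n}}) : maxset (chainb G) C -> #|C| = #|tops G|.+1.
  move=> maxC; have [s sat ->] := maxset_satchain sG ncG maxC; have /andP[p _] := sat.
  have := satchain_size sG pG sat; rewrite {2}/tops imset0 cards0 add0n => ->.
  exact: card_path_cover p.
by move=> C D /card -> /card ->.
Qed.

Lemma lexlt_catl u v w : lexlt (u ++ v) (u ++ w) = lexlt v w.
Proof. by elim: u => //= a u ->; rewrite ltnn eqxx. Qed.

Lemma lexlt_catr u v w z : size u = size v -> lexlt u v -> lexlt (u ++ w) (v ++ z).
Proof.
elim: u v => [|a u IHu] [|b v] //= [suv] /orP[->//|/andP[-> /(IHu _ suv) ->]].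
by rewrite orbT.
Qed.

Lemma labels_cat n (x : {set edge n}) s t :
  labels x (s ++ t) = labels x s ++ labels (last x s) t.
Proof. exact: pairmap_cat. Qed.

(** All these chains have length [#|tops G|], so they sit in a finite type of tuples. *)
Lemma satchains_enum n (G : {set edge n}) :
  simple_graph G -> perfectly_labeled G ->
  exists L : seq (seq {set edge n}), uniq L /\ forall s, (s \in L) = satchain G set0 G s.
Proof.
move=> sG pG; pose T := (#|tops G|).-tuple {set edge n}.
exists [seq val t | t <- enum {: T} & satchain G set0 G (val t)]; split.
  by rewrite map_inj_uniq ?filter_uniq -?enumT ?enum_uniq // => t u; apply: val_inj.
move=> s; apply/mapP/idP => [[t]|sat]; first by rewrite mem_filter => /andP[? _] ->.
have := satchain_size sG pG sat; rewrite {2}/tops imset0 cards0 add0n => /esym/eqP sz.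
by exists (Tuple sz); rewrite // mem_filter mem_enum andbT.
Qed.

(* Order the maximal chains lexicographically by labels.  A face [S] of a chain [s]
   also lying in an earlier chain avoids some element at which [s] does not ascend,
   for otherwise [s] would come first among the chains through [S]; replacing that
   element by the ascending one gives an earlier chain sharing the rest of [s]. *)
Lemma ncbond_shellable n (G : {set edge n}) :
  simple_graph G -> perfectly_labeled G -> ncbond G G -> NC_shellable G.
Proof.
move=> sG pG ncG; have [L0 [uL0 memL0]] := satchains_enum sG pG.
pose le (s t : seq {set edge n}) :=
  (labels set0 s == labels set0 t) || lexlt (labels set0 s) (labels set0 t).
have le_total : total le.
  move=> s t; rewrite /le.
  by case/or3P: (lexlt_total (labels set0 s) (labels set0 t)) => ->; rewrite ?orbT.
have le_trans : transitive le.
  move=> t s u /predU1P[st|st] /predU1P[tu|tu]; rewrite /le.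
  - by rewrite st tu eqxx.
  - by rewrite st tu orbT.
  - by rewrite -tu st orbT.
  - by rewrite (lexlt_trans st tu) orbT.
pose L := sort le L0.
have uL : uniq L by rewrite sort_uniq.
have memL s : (s \in L) = satchain G set0 G s by rewrite mem_sort.
have sL : sorted le L := sort_sorted le_total L0.
pose F (s : seq {set edge n}) := [set z in set0 :: s].
have memF s (z : {set edge n}) : satchain G set0 G s -> (z \in s) = (z \in F s) && (z != set0).
  case/andP=> /path_cover_uniq /= /andP[s0 _] _; rewrite inE in_cons.
  by have [->|] := eqVneq z set0; rewrite ?andbF ?andbT //; apply/negbTE.
(* A saturated chain is recovered from its set by sorting along proper inclusion. *)
have F_inj : {in L &, injective F}.
  move=> s t; rewrite !memL => sats satt E.
  have trans : transitive (fun A B : {set edge n} => A \proper B).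
    by move=> A B C; apply: proper_trans.
  have psorted u : satchain G set0 G u -> sorted (fun A B : {set edge n} => A \proper B) u.
    by case/andP=> p _; apply: path_sorted (sub_path _ p) => A B; apply: cover_proper.
  apply: (irr_sorted_eq trans (@properxx _) (psorted _ sats) (psorted _ satt)) => z.
  by rewrite !memF // E.
exists (map F L); split; first by rewrite map_inj_in_uniq.
  move=> C; apply/mapP/idP => [[s]|maxC].
    by rewrite memL => sat ->; apply: satchain_maxset.
  by have [s sat ->] := maxset_satchain sG ncG maxC; exists s; rewrite ?memL.
move=> k; rewrite size_map => /andP[_ ltk] Fk inSigma S.
have ltL (i : 'I_k) : i < size L := ltn_trans (ltn_ord i) ltk.
have nthF i : i < size L -> nth set0 (map F L) i = F (nth [::] L i).
  by move=> ?; rewrite (nth_map [::]).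
have FkE : Fk = F (nth [::] L k) by apply: nthF.
set s := nth [::] L k in FkE.
have sats : satchain G set0 G s by rewrite -memL mem_nth.
have /andP[ps /eqP ls] := sats.
rewrite {1}/inSigma => /andP[SFk /existsP[i]]; rewrite nthF // => SFi.
set t := nth [::] L i in SFi.
have satt : satchain G set0 G t by rewrite -memL mem_nth.
have /andP[pt /eqP lt] := satt.
have lets : le t s := sorted_ltn_nth le_trans [::] sL _ _ (ltL i) ltk (ltn_ord i).
have nst : s <> t.
  by move/eqP; rewrite nth_uniq // => /eqP E; have := ltn_ord i; rewrite -E ltnn.
have /not_asc[p [x1 [x2 [q [sE x1S lex]]]]] : ~~ asc S set0 s.
  apply/negP => ascs; case: (@asc_lex_first _ G S set0 s t) => //; first by rewrite ls.
    move=> w ws wS; rewrite memF // (subsetP SFi) //=.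
    by move: ws; rewrite memF // => /andP[].
  move=> ltst; case/predU1P: lets => [E|ltts]; first by rewrite E lexlt_irr in ltst.
  by have := lexlt_trans ltst ltts; rewrite lexlt_irr.
move: ps ls; rewrite sE cat_path last_cat /=; set x := last set0 p.
case/and4P=> pp cxx1 cx1x2 pq ls.
have [ncx _ pxx1 _] := coverP _ _ _ cxx1; have [_ ncx2 px1x2 _] := coverP _ _ _ cx1x2.
have sxx2 : x \subset x2 := subset_trans (proper_sub pxx1) (proper_sub px1x2).
(* [c] is the ascending chain from [x] to [x2]. It has length two by counting tops, and it is not
   [[:: x1; x2]], which fails to ascend at [x1]. *)
have [c satc ascc] := greedy_satchain sG pG ncx ncx2 sxx2; have /andP[pc /eqP lc] := satc.
have sz : size c = 2.
  apply: (@addnI #|tops x|); rewrite -(satchain_size sG pG satc).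
  by rewrite (cover_tops sG pG cx1x2) (cover_tops sG pG cxx1) addn2.
have p2 : path (cover G) x [:: x1; x2] by rewrite /= cxx1 cx1x2.
have ltc : lexlt (labels x c) (labels x [:: x1; x2]).
  case: (@asc_lex_first _ G set0 x c [:: x1; x2]) => // [w|E]; first by rewrite inE.
  by move: ascc; rewrite E /= inE /= andbT ltnNge lex.
pose t' := p ++ c ++ q.
have satt' : satchain G set0 G t'.
  by rewrite /satchain /t' !cat_path !last_cat -/x lc pp pc pq ls /=.
have ltt's : lexlt (labels set0 t') (labels set0 s).
  rewrite sE /t' -[_ :: _]/([:: x1; x2] ++ q) !labels_cat lexlt_catl -/x.
  by apply: lexlt_catr => //; rewrite !size_pairmap sz.
(* Sorting puts [t'] before [s], since [t'] is strictly smaller. *)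
have ltjk : index t' L < k.
  rewrite ltnNge; apply/negP => lekj.
  have: le s t'.
    rewrite -[t'](nth_index [::] (_ : t' \in L)) ?memL //.
    move: lekj; rewrite leq_eqVlt => /predU1P[<-|ltkj]; first by rewrite /le eqxx.
    by apply: (sorted_ltn_nth le_trans [::] sL); rewrite // inE index_mem memL.
  case/predU1P => [E|/(lexlt_trans ltt's)]; last by rewrite lexlt_irr.
  by move: ltt's; rewrite E lexlt_irr.
have x1Fk : x1 \in Fk by rewrite FkE inE in_cons sE mem_cat mem_head !orbT.
have cardFk : #|Fk :\ x1| = #|Fk|.-1 by rewrite (cardsD1 x1 Fk) x1Fk.
have SFk' : S \subset Fk :\ x1 by rewrite subsetD1 SFk.
split; first by rewrite -cardFk subset_leq_card.
exists (Fk :\ x1); split=> //; rewrite /inSigma subD1set; apply/existsP.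
exists (Ordinal ltjk); rewrite /= nthF ?index_mem ?memL // nth_index ?memL //.
apply/subsetP => z; rewrite FkE !inE sE !mem_cat !in_cons => /andP[/negbTE->] /=.
have x2c : x2 \in c by rewrite -lc; case: (c) sz => // y c2 _; rewrite /= mem_last.
case/or4P=> [->//|->|/eqP->|->]; rewrite ?orbT //.
by rewrite x2c !orbT.
Qed.

(** * NBC sets and increasing spanning forests *)

Lemma nedge_lt n (x y : 'I_n) : x < y -> nedge x y = (x, y).
Proof. by rewrite /nedge => ->. Qed.

Lemma nedgeC n (x y : 'I_n) : nedge x y = nedge y x.
Proof. by rewrite /nedge; case: (ltngtP x y) => // /val_inj ->. Qed.

Lemma nedge_adj n (X : {set edge n}) x y : simple_graph X -> adj X x y -> nedge x y \in X.
Proof.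
move=> sX /orP[] xyX; have /= lt := sX _ xyX; first by rewrite nedge_lt.
by rewrite nedgeC nedge_lt.
Qed.

Lemma cycle_cycle_edges n (X : {set edge n}) (c : seq 'I_n) :
  simple_graph X -> cycle (adj X) c -> uniq c -> 2 < size c ->
  cycle_edges X [set nedge x (next c x) | x in c].
Proof.
move=> sX cyc uc sc; have szc : size c < n.+1.
  by rewrite ltnS -(card_uniqP uc) -[X in _ <= X]card_ord max_card.
apply/existsP; exists (Ordinal szc); apply/existsP; exists (in_tuple c).
rewrite sc uc /=; apply/andP; split; first by apply/eqP/eq_imset.
by apply/subsetP => _ /imsetP[x xc ->]; apply: nedge_adj (next_cycle cyc xc).
Qed.

(** [k] is the largest vertex of the cycle, [i] and [j] its two neighbours; [f] is the edge
    following [kj], which misses [k] because the cycle has at least three vertices. *)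
Lemma cycle_edges_peak n (X C : {set edge n}) : cycle_edges X C ->
  exists i j k, [/\ i != j, (i, k) \in C, (j, k) \in C
                  & exists2 f : edge n, f \in C & f.2 < k].
Proof.
case/existsP => m /existsP[p /and4P[m_gt2 up /eqP CE _]].
have p0 : 0 < size p by rewrite size_tuple ltnW // ltnW.
have /hasP[k0 k0p _] : has predT p by rewrite has_predT.
case: (@arg_maxnP _ k0 (mem p) val k0p) => k kp kmax.
have [r q rq] := rot_to kp.
have uq : uniq (k :: q) by rewrite -rq rot_uniq.
have {}CE : C = [set nedge x (next (k :: q) x) | x in k :: q].
  rewrite CE; apply/setP => e; apply/imsetP/imsetP => -[x xp ->]; exists x => //.
  - by rewrite -rq mem_rot.
  - by rewrite -rq next_rot.
  - by rewrite -(mem_rot r) rq.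
  - by rewrite -rq next_rot.
have sq : 1 < size q by rewrite -ltnS -[X in _ < X]/(size (k :: q)) -rq size_rot size_tuple.
have lek x : x \in k :: q -> x <= k by rewrite -rq mem_rot => /kmax.
case: q {rq r} => [|x [|y s]] // in uq CE sq lek *.
set c := [:: k, x, y & s] in uq CE lek *.
have /and3P[] := uq; rewrite !inE !negb_or => /and3P[nkx nky _] /andP[nxy _] _.
have ltk z : z \in c -> z != k -> z < k.
  by move=> zc nzk; rewrite ltn_neqAle val_eqE nzk lek.
have nk : next c k = x by rewrite /= eqxx.
have nx : next c x = y by rewrite /= eq_sym (negbTE nkx) eqxx.
have kc : k \in c by rewrite mem_head.
have xc : x \in c by rewrite !inE eqxx orbT.
have yc : y \in c by rewrite !inE eqxx !orbT.
pose w := prev c k; have wc : w \in c by rewrite mem_prev.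
have nw : next c w = k by rewrite /w next_prev.
have nwk : w != k.
  by apply/eqP => E; move: nw; rewrite E nk => /eqP; rewrite eq_sym (negbTE nkx).
have nwx : w != x.
  by apply/eqP => E; move: nw; rewrite E nx => /eqP; rewrite eq_sym (negbTE nky).
have Cnext z : z \in c -> nedge z (next c z) \in C.
  by move=> zc; rewrite CE; apply/imsetP; exists z.
have ltx : x < k by rewrite ltk // eq_sym.
exists w, x, k; split=> //.
- by have := Cnext _ wc; rewrite nw nedge_lt ?ltk.
- by have := Cnext _ kc; rewrite nk nedgeC nedge_lt.
- exists (nedge x y); first by have := Cnext _ xc; rewrite nx.
  by rewrite /nedge; case: ifP => _ //=; rewrite ltk // eq_sym.
Qed.

Lemma incf_acyclic n (F : {set edge n}) : incf F -> acyclic F.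
Proof.
move=> /incfP iF; apply/existsP => -[C cC].
have [i [j [k [nij ik jk _]]]] := cycle_edges_peak cC.
case/existsP: cC => m /existsP[p /and4P[_ _ _ /subsetP CF]].
by case/eqP: nij; apply: iF (CF _ ik) (CF _ jk).
Qed.

(* The triangle on [i < j < k] produces the broken circuit [{ik, jk}]; conversely
   the largest vertex of a cycle carries two edges, neither of them its minimum. *)
Lemma nbcE n (X S : {set edge n}) :
  simple_graph X -> perfectly_labeled X -> nbc X S = (S \subset X) && incf S.
Proof.
move=> sX pX; rewrite /nbc; have [/subsetP SX /=|//] := boolP (S \subset X).
apply/idP/idP => [nb|/incfP iS].
  have noV (i j k : 'I_n) : i < j -> (i, k) \in S -> (j, k) \in S -> false.
    move=> ltij ik jk; apply: contraNT nb => _.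
    have /= ltjk := sX _ (SX _ jk).
    have ij : (i, j) \in X by apply: (pX _ _ k); rewrite ?ltij ?SX.
    have nij : i != j by apply/eqP => E; rewrite E ltnn in ltij.
    have njk : j != k by apply/eqP => E; rewrite E ltnn in ltjk.
    have ltik := ltn_trans ltij ltjk.
    have nik : i != k by apply/eqP => E; rewrite E ltnn in ltik.
    have cyc : cycle (adj X) [:: i; j; k].
      by rewrite /= /adj ij (SX _ jk) (SX _ ik) /= orbT.
    have uc : uniq [:: i; j; k] by rewrite /= !inE negb_or nij nik njk.
    have cC := cycle_cycle_edges sX cyc uc isT; set C := imset _ _ in cC.
    have CE e : e \in C -> [\/ e = (i, j), e = (j, k) | e = (i, k)].
      case/imsetP => x; rewrite !inE => /or3P[]/eqP-> ->.
      - by rewrite /= eqxx nedge_lt //; constructor 1.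
      - by rewrite /= eq_sym (negbTE nij) eqxx nedge_lt //; constructor 2.
      - rewrite /= eq_sym (negbTE nik) eq_sym (negbTE njk) eqxx nedgeC nedge_lt //.
        by constructor 3.
    have ijC : (i, j) \in C.
      by apply/imsetP; exists i; rewrite ?mem_head //= eqxx nedge_lt.
    apply/existsP; exists (C :\ (i, j)); apply/andP; split.
      apply/existsP; exists C; rewrite cC; apply/existsP; exists (i, j).
      rewrite ijC eqxx andbT; apply/forall_inP => f /CE[] ->; rewrite /colex_lt /=; lia.
    by apply/subsetP => e; rewrite !inE => /andP[ne /CE[]E]; move: ne; rewrite E ?eqxx.
  apply/incfP => u w v uv wv; apply: val_inj => /=.
  by have [/noV/(_ uv wv)|/noV/(_ wv uv)|] := ltngtP u w.
apply/existsP => -[B /andP[/existsP[C /andP[cC /existsP[e /and3P[eC]]]]]].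
move=> /forall_inP emin /eqP-> /subsetP CS; have [i [j [k [nij ik jk [f fC ltfk]]]]] := cycle_edges_peak cC.
(* The edge [f] is colex-smaller than any edge with top [k], so such an edge is not the removed
   minimum [e]. *)
have top_ne g : g \in C -> g.2 = k -> g \in S.
  move=> gC gk; apply: CS; rewrite !inE gC andbT; apply: contra (emin _ fC) => /eqP <-.
  by rewrite /colex_lt gk ltfk.
by case/eqP: nij; apply: iS (top_ne _ ik _) (top_ne _ jk _).
Qed.

(** After the step up from [u] to [v], a step down would use a second edge with top [v], that is,
    return to [u]. *)
Lemma incf_path_up n (F : {set edge n}) u v p :
  simple_graph F -> incf F -> (u, v) \in F -> path (adj F) v p -> uniq [:: u, v & p] ->
  path ltn v (map val p).
Proof.
move=> sF /incfP iF; elim: p u v => //= w p IHp u v uv /andP[/orP[vw|wv] pw].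
  by move=> /and3P[_ nv up]; rewrite (sF _ vw) /=; apply: IHp vw pw _; rewrite /= nv.
by rewrite !inE (iF _ _ _ uv wv) eqxx orbT.
Qed.

Lemma incf_increasing n (F : {set edge n}) : simple_graph F -> incf F -> increasing F.
Proof.
move=> sF iF; apply/forallP => r; apply/implyP => /forallP rmin.
apply/forallP => m; apply/forallP => p; apply/implyP => /andP[].
case: (tval p) => //= v q /andP[rv pq] uq; have ltrv : r < v.
  have lerv : r <= v by apply: (implyP (rmin v)); apply: connect1.
  by rewrite ltn_neqAle lerv andbT; case/andP: uq; rewrite inE negb_or => /andP[].
rewrite ltrv /=; apply: incf_path_up pq uq => //.
by case/orP: rv => // /sF /=; rewrite ltnNge ltnW.
Qed.

(* If [i] and [j] are both smaller neighbours of [k], one of them, say [i], does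
   not precede [k] on the path from the root: appending [ki] to that path either
   decreases at the end or closes a cycle. *)
Lemma isf_incf n (F : {set edge n}) :
  simple_graph F -> acyclic F -> increasing F -> incf F.
Proof.
move=> sF acF /forallP incF.
(* On a simple path from the minimum [r] to [k], every smaller neighbour of [k] is the vertex just
   before [k]; hence there is only one. *)
have key (i k : 'I_n) p (r : 'I_n) : (forall v : 'I_n, conn F r v -> r <= v) -> (i, k) \in F ->
    path (adj F) r p -> uniq (r :: p) -> last r p = k ->
    exists q, r :: p = rcons (rcons q i) k.
  move=> rmin ik pp up lp.
  have /= ltik := sF _ ik.
  have ari : adj F k i by rewrite /adj ik orbT.
  have [irp|nirp] := boolP (i \in r :: p); last first.
    have szp : size (rcons p i) < n.+1.
      rewrite ltnS; have u : uniq (r :: rcons p i) by rewrite -rcons_cons rcons_uniq nirp.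
      by have := max_card (mem (r :: rcons p i)); rewrite (card_uniqP u) card_ord => /ltnW.
    have minr : [forall v, conn F r v ==> (r <= v)] by apply/forallP => v; apply/implyP/rmin.
    have /forallP/(_ (Ordinal szp))/forallP/(_ (in_tuple (rcons p i)))/implyP incp :=
      implyP (incF r) minr.
    have urpi : uniq (r :: rcons p i) by rewrite -rcons_cons rcons_uniq nirp.
    have: sorted ltn (map val (r :: rcons p i)).
      by apply: incp; rewrite urpi rcons_path pp lp ari.
    by rewrite /= map_rcons rcons_path last_map lp => /andP[_] /=; rewrite ltnNge ltnW.
  have [a [b lE]] : exists a b, r :: p = a ++ i :: b.
    by case/splitPr: irp => a b; exists a, b.
  have lastb : last i b = k by rewrite -lp -[LHS](last_cat r a (i :: b)) -lE.
  case: b => [|x [|y b]] in lE lastb *.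
  - by rewrite -lastb /= ltnn in ltik.
  - by exists a; rewrite lE -lastb -!cats1 -catA.
  have sortb : path (adj F) i [:: x, y & b].
    by have [] := @cat_sorted2 _ (adj F) a (i :: [:: x, y & b]); rewrite -?lE.
  have ub : uniq [:: i, x, y & b] by move: up; rewrite lE cat_uniq => /and3P[].
  case/negP: acF; apply/existsP; eexists; apply: (cycle_cycle_edges sF _ ub isT).
  by rewrite /cycle rcons_path sortb lastb.
apply/incfP => i j k ik jk.
case: (arg_minnP val (conn0 F k)) => r ckr rmin.
have {}rmin v : conn F r v -> r <= v by move=> crv; apply: rmin; apply: conn_trans crv.
have /connectP[p0 pp0 lp0] : conn F r k by rewrite conn_sym.
case: (shortenP pp0) lp0 => p pp up _ /esym lp.
have [q1 E1] := key i k p r rmin ik pp up lp.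
have [q2] := key j k p r rmin jk pp up lp.
by rewrite E1 => /rcons_inj[/rcons_inj[_ ->]].
Qed.

Lemma isfE n (X F : {set edge n}) : simple_graph X -> isf X F = (F \subset X) && incf F.
Proof.
move=> sX; rewrite /isf; have [sFX /=|//] := boolP (F \subset X).
have sF := simple_sub sFX sX; apply/andP/idP => [[]|iF]; first exact: isf_incf.
by split; [apply: incf_acyclic | apply: incf_increasing].
Qed.

(* For perfectly labeled [X] these are both the noncrossing NBC sets of [X] and its
   noncrossing increasing spanning forests. *)
Definition ncincf {n : nat} (X : {set edge n}) : {set {set edge n}} :=
  [set F : {set edge n} | [&& F \subset X, incf F & noncrossing_edges F]].

Lemma ncnbcE n (X : {set edge n}) k : simple_graph X -> perfectly_labeled X ->
  ncnbc X k = #|[set F : {set edge n} | (F \in ncincf X) && (#|F| == k)]|.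
Proof. by move=> sX pX; apply: eq_card => F; rewrite !inE nbcE // -!andbA. Qed.

Lemma ncisfE n (X : {set edge n}) k : simple_graph X ->
  ncisf X k = #|[set F : {set edge n} | (F \in ncincf X) && (#|F| == k)]|.
Proof. by move=> sX; apply: eq_card => F; rewrite !inE isfE // -!andbA. Qed.

(** * The Moebius function *)

Lemma ncincfP n (X F : {set edge n}) :
  reflect [/\ F \subset X, incf F & noncrossing_edges F] (F \in ncincf X).
Proof. by rewrite inE; apply: and3P. Qed.

Lemma ncbond_cl_ncincf n (G F : {set edge n}) :
  simple_graph G -> F \in ncincf G -> ncbond G (cl G F).
Proof.
move=> sG /ncincfP[sFG _ nF]; apply: ncbond_cl => //.
exact: noncrossing_edges_comps (simple_sub sFG sG) nF.
Qed.

Lemma card_ncincf n (G F : {set edge n}) :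
  simple_graph G -> F \in ncincf G -> #|F| = #|tops (cl G F)|.
Proof.
move=> sG /ncincfP[sFG iF _]; rewrite tops_cl ?card_tops_incf //.
exact: incf_perfectly_labeled.
Qed.

(** A forest in [H] with as many edges as [H] has tops has the same tops, hence the same components,
    and so spans [H]. *)
Lemma ncincf_cl n (G H F : {set edge n}) :
  simple_graph G -> perfectly_labeled G -> bond G H ->
  (F \in ncincf H) && (#|F| == #|tops H|) = (F \in ncincf G) && (cl G F == H).
Proof.
move=> sG pG bH; have [sHG _] := andP bH.
apply/andP/andP => -[FH /eqP E].
  have [sFH iF nF] := ncincfP _ _ FH; have sFG := subset_trans sFH sHG.
  split; first exact/ncincfP.
  have tE : tops F = tops H.
    by apply/eqP; rewrite eqEcard (tops_sub sFH) (card_tops_incf iF) E /=.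
  have cE x y : conn F x y = conn H x y.
    apply: conn_eq_tops; rewrite ?tE //; first exact: bond_simple sG.
    exact: bond_perfectly_labeled pG.
  by rewrite -[in X in _ == X](cl_bond bH); apply/eqP/setP => e; rewrite !inE cE.
have [sFG iF nF] := ncincfP _ _ FH; rewrite -E -(card_ncincf sG FH) eqxx; split=> //.
by apply/ncincfP; rewrite subset_cl.
Qed.

(** Each single edge spans a noncrossing bond, so the maximum contains every edge of [G]. *)
Lemma has_max_ncbond n (G : {set edge n}) :
  simple_graph G -> has_max G -> ncbond G G.
Proof.
move=> sG [T [ncT maxT]]; suff sGT : G \subset T.
  have /andP[/andP[sTG _] _] := ncT; have TG : T = G by apply/eqP; rewrite eqEsubset sTG.
  by rewrite TG in ncT.
apply/subsetP => e eG; have FG : [set e] \in ncincf G.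
  apply/ncincfP; split; first by rewrite sub1set.
    by apply/forall_inP => f /set1P->; apply/forall_inP => g /set1P->; rewrite !eqxx.
  by apply/forall_inP => f /set1P->; apply/forall_inP => g /set1P->; rewrite /crossb !ltnn.
apply: (subsetP (maxT _ (ncbond_cl_ncincf sG FG))).
by rewrite (subsetP (subset_cl _)) ?set11 ?sub1set.
Qed.

(* The smallest edge [ab] of [H] shares its top with no other edge and crosses no
   edge, so adding or removing it preserves noncrossing increasing forests. *)
Lemma ncincf_cone n (G H : {set edge n}) :
  simple_graph G -> perfectly_labeled G -> ncbond G H -> H != set0 ->
  exists2 e, e \in H & forall F, (e |: F \in ncincf H) = (F :\ e \in ncincf H).
Proof.
move=> sG pG /andP[bH ncH] /set0Pn[e0 e0H].
have sH := bond_simple bH sG; have pH := bond_perfectly_labeled bH pG.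
case: (arg_minnP (@colex_key n) e0H) => -[a b] /= abH abmin.
have {}abH : (a, b) \in H := abH.
have top_ge u v : (u, v) \in H -> b <= v by move=> /abmin/colex_key_top.
have top_b u : (u, b) \in H -> u = a.
  move=> ubH; apply: val_inj; have [ltua|ltau|//] := ltngtP u a.
    by have := abmin _ ubH; rewrite leqNgt -colex_ltE /colex_lt /= ltnn eqxx ltua.
  have ltub : u < b := sH _ ubH.
  by have := pH a u b _ abH ubH; rewrite ltau ltub => /(_ isT)/top_ge; rewrite leqNgt ltub.
have /= ltab := sH _ abH.
have nocross u v : (u, v) \in H -> ~~ crossb (a, b) (u, v).
  move=> uvH; have /= ltuv := sH _ uvH; rewrite /crossb negb_or /=; apply/andP; split.
    (* A crossing would put [a] and [u] in one block of [H], making [u] a top below [b]. *)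
    apply/negP => /and3P[ltau ltub ltbv].
    have cau : conn H a u.
      have /noncrossing_compsP/(_ a u b v) := ncH; apply=> //.
        exact: (conn_edge abH).
      exact: (conn_edge uvH).
    by have /topsP[w /top_ge] := conn_tops sH pH cau ltau; rewrite leqNgt ltub.
  by apply/negP => /and3P[_ _]; rewrite ltnNge (top_ge _ _ uvH).
exists (a, b) => // F; apply/idP/idP => /ncincfP[sFH iF nF]; apply/ncincfP.
  have sub : F :\ (a, b) \subset (a, b) |: F.
    exact: subset_trans (subD1set _ _) (subsetUr _ _).
  split; first exact: subset_trans sub sFH.
    exact: incf_sub sub iF.
  exact: noncrossing_edges_sub sub nF.
have FE : (a, b) |: F = (a, b) |: (F :\ (a, b)).
  by apply/setP => e; rewrite !inE; case: (e == _).
rewrite FE; split.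
- by rewrite subUset sub1set abH.
- apply/incfP => u w v; rewrite !(in_setU1 _ (a, b)).
  case/predU1P=> [[-> ->]|uv] /predU1P[|wv].
  + by case.
  + by apply/esym/top_b/(subsetP sFH).
  + by move=> [-> E]; apply: top_b; rewrite -E (subsetP sFH).
  + by move/incfP: iF => iF; apply: iF uv wv.
- apply/forall_inP => e; rewrite in_setU1 => /predU1P[->|eF].
    apply/forall_inP => f; rewrite in_setU1 => /predU1P[->|]; first by rewrite /crossb !ltnn.
    by case: f => u v /(subsetP sFH)/nocross.
  apply/forall_inP => f; rewrite in_setU1 => /predU1P[->|fF].
    by rewrite /crossb orbC; case: e eF => u v /(subsetP sFH)/nocross.
  exact: (forall_inP (forall_inP nF _ eF)).
Qed.

(** Toggling the cone edge [e] is a sign-reversing involution. *)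
Lemma sum_ncincf0 n (G H : {set edge n}) :
  simple_graph G -> perfectly_labeled G -> ncbond G H -> H != set0 ->
  (\sum_(F in ncincf H) (-1) ^+ #|F| = 0 :> int)%R.
Proof.
move=> sG pG ncH H0; have [e eH cone] := ncincf_cone sG pG ncH H0.
pose tog (F : {set edge n}) := if e \in F then F :\ e else e |: F.
have togK : involutive tog.
  move=> F; rewrite /tog; have [eF|eF] := boolP (e \in F).
    by rewrite setD11 setD1K.
  by rewrite setU11 setU1K.
have tog_mem F : (tog F \in ncincf H) = (F \in ncincf H).
  rewrite /tog; have [eF|eF] := boolP (e \in F); first by rewrite -cone (setUidPr _) ?sub1set.
  by have := cone (e |: F); rewrite setU1K // setUA setUid.
have tog_sign F : ((-1) ^+ #|tog F| = - (-1) ^+ #|F| :> int)%R.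
  rewrite /tog; have [eF|eF] := boolP (e \in F).
    by rewrite [X in (_ = - _ ^+ X)%R](cardsD1 e) eF exprS mulN1r opprK.
  by rewrite cardsU1 eF exprS mulN1r.
set s := (\sum_(F in _) _)%R; have : (s = - s)%R.
  rewrite {1}/s (reindex_inj (inv_inj togK)) /= -sumrN.
  by apply: eq_big => F; rewrite ?tog_mem ?tog_sign.
lia.
Qed.

(** A forest lies in the bond [H] exactly when the bond it spans does; the sum is split by that
    bond. *)
Lemma sum_cl_ncincf n (G H : {set edge n}) (R : nmodType) (f : {set edge n} -> R) :
  simple_graph G -> bond G H ->
  (\sum_(K | ncbond G K && (K \subset H)) \sum_(F | (F \in ncincf G) && (cl G F == K)) f F
   = \sum_(F in ncincf H) f F)%R.
Proof.
move=> sG bH; have [sHG _] := andP bH.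
have memE F : (F \in ncincf H) = (F \in ncincf G) && (cl G F \subset H).
  apply/idP/andP => [/ncincfP[sFH iF nF]|[/ncincfP[sFG iF nF] sclH]].
    by split; [apply/ncincfP; split=> //; apply: subset_trans sHG | apply: cl_min].
  by apply/ncincfP; split=> //; apply: subset_trans sclH; apply: subset_cl.
rewrite [RHS](eq_bigl _ _ memE).
rewrite [RHS](partition_big (cl G) (fun K => ncbond G K && (K \subset H))) /=; last first.
  by move=> F /andP[FG sFH]; rewrite sFH ncbond_cl_ncincf.
apply: eq_bigr => K /andP[_ sKH]; apply: eq_bigl => F.
by have [->|] := eqVneq (cl G F) K; rewrite ?sKH ?andbT ?andbF.
Qed.

(** The signed counts over the fibres of [cl G] satisfy the recursion of [mu]: together, the fibres
    over all [K] below [H] sum to zero. *)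
Lemma mobius_ncincf n (G : {set edge n}) (mu : {set edge n} -> int) H :
  simple_graph G -> perfectly_labeled G -> mobius_fun G mu -> ncbond G H ->
  (mu H = \sum_(F | (F \in ncincf G) && (cl G F == H)) (-1) ^+ #|F|)%R.
Proof.
move=> sG pG [mu0 muS]; have [m] := ubnP #|H|; elim: m H => // m IHm H ltm ncH.
have [bH _] := andP ncH; have [H0|H0] := eqVneq H set0.
  rewrite H0 mu0 (big_pred1 set0) ?cards0 // => F /=; rewrite -H0 -ncincf_cl //.
  rewrite H0 /tops imset0 cards0 cards_eq0; apply/andb_idl => /eqP->.
  apply/ncincfP; split; rewrite ?sub0set //; last first.
    by apply/noncrossing_edgesP => ? ? ? ?; rewrite inE.
  by apply/incfP => ? ? ?; rewrite inE.
rewrite (muS _ ncH H0); apply/esym/eqP; rewrite -subr_eq0 opprK; apply/eqP.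
apply: etrans (sum_ncincf0 sG pG ncH H0); rewrite -(sum_cl_ncincf _ sG bH).
rewrite [RHS](bigD1 H) ?ncH ?subxx //=; congr (_ + _)%R.
apply: eq_big => [K|K /andP[ncK pKH]].
  by rewrite properEneq -andbA [in RHS]andbC -andbA; do !bool_congr.
by apply: IHm => //; apply: leq_trans (proper_card pKH) _.
Qed.

(** * Signed counts by size and the characteristic polynomial *)

Lemma sum_signs n (A : {set {set edge n}}) k :
  (\sum_(F in A | #|F| == k) (-1) ^+ #|F| =
   (-1) ^+ k * #|[set F : {set edge n} | (F \in A) && (#|F| == k)]|%:Z :> int)%R.
Proof.
rewrite (eq_bigr (fun=> (-1) ^+ k)%R) => [|F /andP[_ /eqP->]] //.
rewrite sumr_const -mulr_natr; congr (_ * _)%R; rewrite natz; congr Posz.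
by apply: eq_card => F; rewrite inE.
Qed.

Lemma mobius_rank n (G : {set edge n}) (mu : {set edge n} -> int) H :
  simple_graph G -> perfectly_labeled G -> mobius_fun G mu -> ncbond G H ->
  (mu H = (-1) ^+ #|tops H| *
     #|[set F : {set edge n} | (F \in ncincf H) && (#|F| == #|tops H|)]|%:Z)%R.
Proof.
move=> sG pG muG ncH; rewrite (mobius_ncincf sG pG muG ncH) -sum_signs.
by apply: eq_bigl => F; rewrite -ncincf_cl //; case/andP: ncH.
Qed.

(** Expanding each [mu H] over its fibre, where the rank of [H] is the size of the forest, gives one
    sum over all forests, regrouped by size. *)
Lemma charpoly_ncincf n (G : {set edge n}) (mu : {set edge n} -> int) :
  simple_graph G -> perfectly_labeled G -> ncbond G G -> mobius_fun G mu ->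
  (charpoly G mu =
   \sum_(k < #|G|.+1)
     ((-1) ^+ k * #|[set F : {set edge n} | (F \in ncincf G) && (#|F| == k)]|%:Z)%:P *
     'X^(rkP G - k))%R.
Proof.
move=> sG pG ncG muG; have bG := proj1 (andP ncG).
pose term (F : {set edge n}) : {poly int} := (((-1) ^+ #|F|)%:P * 'X^(rkP G - #|F|))%R.
transitivity (\sum_(F in ncincf G) term F)%R.
  rewrite -(sum_cl_ncincf term sG bG) /charpoly; apply: eq_big => [H|H ncH].
    by rewrite -[LHS]andbT; apply: andb_id2l => /andP[/andP[->]].
  rewrite (mobius_ncincf sG pG muG ncH) rmorph_sum /= mulr_suml.
  by apply: eq_bigr => F /andP[FG /eqP<-]; rewrite /term
    rk_tops ?ncbond_cl_ncincf // -card_ncincf.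
rewrite (partition_big (fun F : {set edge n} => inord #|F| : 'I_#|G|.+1) xpredT) //=.
apply: eq_bigr => k _; rewrite -sum_signs rmorph_sum /= mulr_suml.
apply: eq_big => [F|F /andP[FG]].
  apply: andb_id2l => /ncincfP[sFG _ _].
  by rewrite -val_eqE /= inordK // ltnS subset_leq_card.
have [sFG _ _] := ncincfP _ _ FG.
by rewrite -val_eqE /= inordK ?ltnS ?subset_leq_card // /term => /eqP->.
Qed.

Theorem theorem5p8 (n : nat) (G : {set edge n}) :
  simple_graph G -> perfectly_labeled G -> has_max G ->
  [/\ (* (a) *)
      graded G /\ (forall H, ncbond G H -> rk G H = (n - cc H)%N),
      (* (b) *)
      EL_min_colex G /\ NC_shellable G &
      (* (c) *)
      forall mu : {set edge n} -> int, mobius_fun G mu ->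
        [/\ forall H, ncbond G H ->
              mu H = ((-1) ^+ (n - cc H) * (ncnbc H (n - cc H))%:Z)%R /\
              mu H = ((-1) ^+ (n - cc H) * (ncisf H (n - cc H))%:Z)%R,
            charpoly G mu =
              (\sum_(k < #|G|.+1) ((-1) ^+ k * (ncnbc G k)%:Z)%:P * 'X^(rkP G - k))%R &
            charpoly G mu =
              (\sum_(k < #|G|.+1) ((-1) ^+ k * (ncisf G k)%:Z)%:P * 'X^(rkP G - k))%R]].
Proof.
move=> sG pG /(has_max_ncbond sG) ncG.
have sH H : ncbond G H -> simple_graph H by case/andP=> /bond_simple + _; apply.
have pH H : ncbond G H -> perfectly_labeled H.
  by case/andP=> /bond_perfectly_labeled + _; apply.
have ccE H : ncbond G H -> n - cc H = #|tops H|.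
  by move=> ncH; apply: cc_tops; [apply: sH | apply: pH].
split; first by split=> [|H ncH]; [apply: ncbond_graded | rewrite rk_tops ?ccE].
  by split; [apply: satchain_EL | apply: ncbond_shellable].
move=> mu muG; split=> [H ncH||].
- rewrite ccE // ncnbcE ?ncisfE; [|exact: sH|exact: sH|exact: pH].
  by split; exact: (mobius_rank sG pG muG ncH).
- rewrite (charpoly_ncincf sG pG ncG muG); apply: eq_bigr => k _.
  by rewrite ncnbcE.
- rewrite (charpoly_ncincf sG pG ncG muG); apply: eq_bigr => k _.
  by rewrite ncisfE.
Qed.
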